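(* Let $G=SO(4)$. The Chern-Simons form $I_\Delta(TPf(\theta))\in\Omega^3(PSO(4))$ of the Euler class of $ESO(4)\to BSO(4)$ is the sum $T\bar{E}_{0,3}+T\bar{E}_{1,2}$ of $$T\bar{E}_{0,3}=\frac{-1}{96\pi^2}\sum_{\tau\in\mathfrak{S}_4}\mathrm{sgn}(\tau)\,(\theta_0)_{\tau(1)\tau(2)}\wedge(\theta_0^2)_{\tau(3)\tau(4)}\in\Omega^3(PG(0)),\qquad PG(0)=SO(4),$$ $$T\bar{E}_{1,2}=\frac{-1}{64\pi^2}\sum_{\tau\in\mathfrak{S}_4}\mathrm{sgn}(\tau)\Big((\theta_0)_{\tau(1)\tau(2)}\wedge(\theta_1)_{\tau(3)\tau(4)}+(\theta_0)_{\tau(3)\tau(4)}\wedge(\theta_1)_{\tau(1)\tau(2)}\Big)\in\Omega^2(PG(1)),$$ where $PG(1)=SO(4)\times SO(4)$. It satisfies $$d''T\bar{E}_{0,3}=0,\qquad d'T\bar{E}_{0,3}+d''T\bar{E}_{1,2}=\bar{E}_{1,3},\qquad d'T\bar{E}_{1,2}=\bar{E}_{2,2},$$ where $\bar{E}_{1,3}\in\Omega^3(PG(1))$ and $\bar{E}_{2,2}\in\Omega^2(PG(2))$ are the components of the cocycle $I_\Delta(\mathrm{Pf}(\Omega))\in\Omega^4(PSO(4))$ representing the Euler class.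
   Context: For a Lie group $G$, $PG$ is the simplicial manifold with $PG(q)=G^{q+1}\ni(g_0,\dots,g_q)$ and face operators $\bar{\varepsilon}_i:PG(q)\to PG(q-1)$, $\bar{\varepsilon}_i(g_0,\dots,g_q)=(g_0,\dots,g_{i-1},g_{i+1},\dots,g_q)$, $0\le i\le q$. The double complex is $\Omega^{q,r}(PG)=\Omega^r(PG(q))$ (smooth differential forms), with $d'=\sum_{i=0}^{q+1}(-1)^i\bar{\varepsilon}_i^*:\Omega^r(PG(q))\to\Omega^r(PG(q+1))$ and $d''=(-1)^q\times$(exterior differential) on $\Omega^r(PG(q))$; $\Omega^*(PG)$ also denotes the total complex, with differential $d'+d''$. Let $\theta_i=\mathrm{pr}_i^*\bar\theta$, where $\mathrm{pr}_i$ is the projection to the factor $g_i$ and $\bar\theta=g^{-1}dg$ is the Maurer-Cartan form of $G$ (so $d\theta_i=-\theta_i\wedge\theta_i$); $(\theta_i)_{ab}$ denotes the $(a,b)$ matrix entry and $\theta_i^2=\theta_i\wedge\theta_i$. Let $\Delta^q$ be the standard simplex with barycentric coordinates $(t_0,\dots,t_q)$. The canonical simplicial connection $\theta$ is given on $\Delta^q\times PG(q)$ by $\theta=t_0\theta_0+\cdots+t_q\theta_q$, with curvature $\Omega=d\theta+\frac12[\theta,\theta]$, where $d$ is the exterior differential on $\Delta^q\times PG(q)$ and $\frac12[\theta,\theta]=\theta\wedge\theta$. For a family $\alpha$ of forms on the $\Delta^q\times PG(q)$, $I_\Delta(\alpha)$ is the cochain whose component on $PG(q)$ is the fibre integral $\int_{\Delta^q}\alpha|_{\Delta^q\times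 PG(q)}$, computed by moving the $dt$'s to the left and orienting $\Delta^q$ by $dt_1\wedge\cdots\wedge dt_q$ (for $q=0$ it is restriction to $PG(0)$). $\mathrm{Pf}$ is the normalized Pfaffian, with associated symmetric bilinear form on $\mathfrak{so}(4)$ $$\mathrm{Pf}(A,B)=\frac{1}{32\pi^2}\sum_{\tau\in\mathfrak{S}_4}\mathrm{sgn}(\tau)A_{\tau(1)\tau(2)}B_{\tau(3)\tau(4)},$$ extended to $\mathfrak{so}(4)$-valued forms by wedging entries in the order written. Write $\mathrm{Pf}(\Omega)=\mathrm{Pf}(\Omega,\Omega)$ and $\mathrm{Pf}(\alpha\wedge\beta)=\mathrm{Pf}(\alpha,\beta)$. The cocycle $I_\Delta(\mathrm{Pf}(\Omega))$ is the pullback to $PSO(4)$ of the Bott-Shulman-Stasheff form representing the Euler class. Finally $$TPf(\theta)=2\int_0^1\mathrm{Pf}\Big(\theta\wedge\big(t\,\Omega+\tfrac12t(t-1)[\theta,\theta]\big)\Big)\,dt .$$ A Chern-Simons form of a cocycle in $\Omega^*(PG)$ is a cochain of total degree one less whose image under $d'+d''$ is that cocycle. *)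

(* Defs.v *)
From HB Require Import structures.
From mathcomp Require Import all_boot all_order all_algebra all_fingroup.
From mathcomp Require Import all_classical all_reals all_analysis.

Set Implicit Arguments.
Unset Strict Implicit.
Unset Printing Implicit Defensive.

Import Order.TTheory GRing.Theory Num.Theory.
Import numFieldNormedType.Exports.

Local Open Scope classical_set_scope.
Local Open Scope ring_scope.

(* A manifold is given as an embedded submanifold S of a finite-dimensional
   normed space V. An r-form is a total function of a point of V and of r
   vectors of V. Only its values at points of S on vectors tangent to S are
   meaningful, so two forms on S are compared with [form_eq S], never with
   Leibniz equality. *)
Definition form (R : realType) (V : normedModType R) (r : nat) :=
  V -> ('I_r -> V) -> R.

Section EmbeddedManifold.
Context {R : realType} {V : normedModType R}.

Definition tangent (S : set V) (p v : V) : Prop :=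
  exists c : R -> V,
    [/\ c 0 = p, \forall s \near 0, S (c s) & is_derive (0 : R) (1 : R) c v].

Definition form_eq (S : set V) r (w w' : form V r) : Prop :=
  forall p v, S p -> (forall i, tangent S p (v i)) -> w p v = w' p v.

Fixpoint Ck (k : nat) (U : set V) (f : V -> R) : Prop :=
  match k with
  | 0%N => forall x, U x -> {for x, continuous f}
  | k'.+1 => (forall x, U x -> differentiable f x) /\
             (forall v, Ck k' U (fun x => 'D_v f x))
  end.

Definition smooth (U : set V) (f : V -> R) : Prop := forall k, Ck k U f.

Definition multilinear_form r (a : ('I_r -> V) -> R) : Prop :=
  forall (v : 'I_r -> V) (i : 'I_r) (k : R) (x y : V),
    a [eta v with i |-> k *: x + y] =
    k * a [eta v with i |-> x] + a [eta v with i |-> y].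

Definition alternating_form r (a : ('I_r -> V) -> R) : Prop :=
  forall (v : 'I_r -> V) (i j : 'I_r), i != j -> v i = v j -> a v = 0.

Definition smooth_form_on_open (U : set V) r (w : form V r) : Prop :=
  (forall x, U x -> multilinear_form (w x) /\ alternating_form (w x)) /\
  (forall v, smooth U (fun x => w x v)).

Definition smooth_extension (S : set V) r (w w' : form V r) : Prop :=
  exists U : set V,
    [/\ open U, S `<=` U, smooth_form_on_open U w' & form_eq S w' w].

(* w represents an element of Omega^r(S) *)
Definition smooth_form (S : set V) r (w : form V r) : Prop :=
  exists w', smooth_extension S w w'.

Definition zero_form r : form V r := fun _ _ => 0.
Arguments zero_form r : clear implicits.

(* Exterior differential on an open subset of V. *)
Definition ext_diff_open r (w : form V r) : form V r.+1 :=
  fun p v => \sum_(i < r.+1)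
    (-1) ^+ i * 'D_(v i) (fun x => w x (fun j => v (lift i j))) p.

(* Exterior differential on S: restrict to S the differential of a smooth
   extension of w to a neighbourhood of S. On S the result does not depend on
   the extension, since restriction to a submanifold commutes with the
   exterior differential. The value is meaningful only if [smooth_form S w]. *)
Definition ext_diff (S : set V) r (w : form V r) : form V r.+1 :=
  if pselect (smooth_form S w) is left e
  then ext_diff_open (projT1 (cid e)) else zero_form r.+1.

(* The convention is (a /\ b)(x, y) = a(x) b(y) - a(y) b(x) for 1-forms. *)
Definition wedge r s (a : form V r) (b : form V s) : form V (r + s) :=
  fun p v => ((r`! * s`!)%:R)^-1 *
    \sum_(sigma : 'S_(r + s)) (-1) ^+ sigma *
      (a p (fun i => v (sigma (lshift s i))) *
       b p (fun j => v (sigma (rshift r j)))).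

(* Matrix-valued forms are matrices of forms. *)
Definition mxform_add n r (A B : 'M[form V r]_n) : 'M[form V r]_n :=
  \matrix_(a, b) (fun p v => A a b p v + B a b p v).

Definition mxform_scale n r (k : R) (A : 'M[form V r]_n) : 'M[form V r]_n :=
  \matrix_(a, b) (fun p v => k * A a b p v).

Definition mxwedge n r s (A : 'M[form V r]_n) (B : 'M[form V s]_n) :
    'M[form V (r + s)]_n :=
  \matrix_(a, b) (fun p v => \sum_c wedge (A a c) (B c b) p v).

Definition mxext_diff (S : set V) n r (A : 'M[form V r]_n) :
    'M[form V r.+1]_n :=
  map_mx (@ext_diff S r) A.

Definition Pf r s (A : 'M[form V r]_4) (B : 'M[form V s]_4) :
    form V (r + s) :=
  fun p v => (32 * pi ^+ 2)^-1 *
    \sum_(tau : 'S_4) (-1) ^+ tau *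
      wedge (A (tau 0) (tau 1)) (B (tau 2%:R) (tau 3%:R)) p v.

End EmbeddedManifold.

Arguments zero_form {R V} r.

Definition pullback (R : realType) (V W : normedModType R) (f : V -> W) r
    (w : form W r) : form V r :=
  fun p v => w (f p) (fun k => 'd f p (v k)).

Definition SO (R : realType) (n : nat) : set 'M[R]_n :=
  [set g | g^T *m g = 1%:M /\ \det g = 1].

(* The ambient space of PG(q): the i-th row of a point is the matrix g_i,
   flattened by mxvec. *)
Definition ambPG (R : realType) (n q : nat) : normedModType R :=
  'M[R]_(q.+1, n * n).

(* The ambient space of Delta^q x PG(q), with barycentric coordinates on the
   first factor. *)
Definition ambDPG (R : realType) (n q : nat) : normedModType R :=
  ('rV[R]_q.+1 * 'M[R]_(q.+1, n * n))%type.

Section SimplicialManifold.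
Context {R : realType} {n : nat}.

Definition pr q (i : 'I_q.+1) (p : ambPG R n q) : 'M[R]_n := vec_mx (row i p).

Definition PG (G : set 'M[R]_n) q : set (ambPG R n q) :=
  [set p | forall i, G (pr i p)].

Definition face q (i : 'I_q.+2) (p : ambPG R n q.+1) : ambPG R n q :=
  row' i p.

Definition bary q (i : 'I_q.+1) (x : ambDPG R n q) : R := x.1 0 i.

Definition toPG q (x : ambDPG R n q) : ambPG R n q := x.2.

(* The factor Delta^q is replaced by the affine hyperplane it spans, so that
   the product is a manifold without boundary: forms on Delta^q x PG(q) are
   smooth up to the boundary. Integration is over Delta^q only. *)
Definition DPG (G : set 'M[R]_n) q : set (ambDPG R n q) :=
  [set x | \sum_i bary i x = 1 /\ PG G (toPG x)].

Definition maurer_cartan : 'M[form 'M[R]_n 1]_n :=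
  \matrix_(a, b) (fun g v => (invmx g *m v ord0) a b).

Definition theta q (i : 'I_q.+1) : 'M[form (ambPG R n q) 1]_n :=
  \matrix_(a, b) pullback (pr i) (maurer_cartan a b).

Definition connection q : 'M[form (ambDPG R n q) 1]_n :=
  \matrix_(a, b) (fun x v =>
    \sum_i bary i x * pullback (@toPG q) (theta i a b) x v).

(* [theta, theta] / 2 is theta /\ theta. *)
Definition curvature (G : set 'M[R]_n) q : 'M[form (ambDPG R n q) 2]_n :=
  mxform_add (mxext_diff (DPG G (q := q)) (connection q))
             (mxwedge (connection q) (connection q)).

(* An element of the product of all Omega^r(PG(q)), indexed by q and r. *)
Definition cochain := forall q r, form (ambPG R n q) r.

Definition cochain_eq (G : set 'M[R]_n) (c c' : cochain) : Prop :=
  forall q r, form_eq (PG G (q := q)) (c q r) (c' q r).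

Definition zero_cochain : cochain := fun q r => zero_form r.

(* c represents an element of degree m of the total complex. *)
Definition total_cochain (G : set 'M[R]_n) (m : nat) (c : cochain) : Prop :=
  forall q r, smooth_form (PG G (q := q)) (c q r) /\
    ((q + r)%N != m -> form_eq (PG G (q := q)) (c q r) (zero_form r)).

Definition d' q r (w : form (ambPG R n q) r) : form (ambPG R n q.+1) r :=
  fun p v => \sum_(i < q.+2) (-1) ^+ i * pullback (face i) w p v.

Definition d'' (G : set 'M[R]_n) q r (w : form (ambPG R n q) r) :
    form (ambPG R n q) r.+1 :=
  fun p v => (-1) ^+ q * ext_diff (PG G (q := q)) w p v.

Definition total_diff (G : set 'M[R]_n) (c : cochain) : cochain :=
  fun q r p v =>
    (match q return form (ambPG R n q) r with
     | 0%N => zero_form r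
     | q'.+1 => d' (c q' r)
     end p v) +
    (match r return form (ambPG R n q) r with
     | 0%N => zero_form 0
     | r'.+1 => d'' G (c q r')
     end p v).

Definition cocycle (G : set 'M[R]_n) (m : nat) (c : cochain) : Prop :=
  total_cochain G m c /\ cochain_eq G (total_diff G c) zero_cochain.

Definition chern_simons_form (G : set 'M[R]_n) (m : nat) (T E : cochain) :
    Prop :=
  [/\ cocycle G m.+1 E, total_cochain G m T
    & cochain_eq G (total_diff G T) E].

(* Iterated integral of F [:: t_1; ...; t_q] over
   { t_1, ..., t_q >= 0, t_1 + ... + t_q <= s }. *)
Fixpoint simplex_integral (q : nat) (s : R) (F : seq R -> R) : R :=
  match q with
  | 0%N => F [::]
  | q'.+1 => \int[lebesgue_measure]_(t in `[0, s])
               simplex_integral q' (s - t) (fun l => F (t :: l))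
  end.

Definition barycentric q (l : seq R) : 'rV[R]_q.+1 :=
  \row_(i < q.+1) nth 0 (1 - \sum_(t <- l) t :: l) i.

(* The coordinate vector field of t_(i+1) in the chart (t_1, ..., t_q) of
   Delta^q, where t_0 = 1 - t_1 - ... - t_q. *)
Definition simplex_dir q (i : 'I_q) : 'rV[R]_q.+1 :=
  delta_mx 0 (lift ord0 i) - delta_mx 0 ord0.

(* Fibre integration: the first q arguments of the form are the coordinate
   fields of t_1, ..., t_q, so that dt_1 /\ ... /\ dt_q /\ b is sent to the
   integral of b. *)
Definition I_Delta m (alpha : forall q, form (ambDPG R n q) m) : cochain :=
  fun q r =>
    match (q + r)%N =P m with
    | ReflectT e => fun g v =>
        simplex_integral q 1 (fun l =>
          alpha q ((barycentric q l, g) : ambDPG R n q)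
            (fun k => match fintype.split (cast_ord (esym e) k) with
                      | inl i => (simplex_dir i, 0)
                      | inr j => (0, v j)
                      end))
    | ReflectF _ => zero_form r
    end.

End SimplicialManifold.

Arguments connection {R n} q.
Arguments zero_cochain {R n} q r.
Arguments I_Delta {R n m} alpha q r.
Arguments theta {R n q} i.

Section EulerClass.
Context {R : realType}.

Definition PfOmega q : form (ambDPG R 4 q) 4 :=
  Pf (curvature (@SO R 4) q) (curvature (@SO R 4) q).

Definition TPf q : form (ambDPG R 4 q) 3 :=
  fun x v => 2 * \int[lebesgue_measure]_(t in `[0, 1])
    Pf (connection q)
       (mxform_add (mxform_scale t (curvature (@SO R 4) q))
          (mxform_scale (t * (t - 1)) (mxwedge (connection q) (connection q))))
       x v.

Definition TE03 : form (ambPG R 4 0) 3 :=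
  fun p v => - 1 / (96 * pi ^+ 2) *
    \sum_(tau : 'S_4) (-1) ^+ tau *
      wedge (theta 0 (tau 0) (tau 1))
            (mxwedge (theta 0) (theta 0) (tau 2%:R) (tau 3%:R)) p v.

Definition TE12 : form (ambPG R 4 1) 2 :=
  fun p v => - 1 / (64 * pi ^+ 2) *
    \sum_(tau : 'S_4) (-1) ^+ tau *
      (wedge (theta 0 (tau 0) (tau 1)) (theta 1 (tau 2%:R) (tau 3%:R)) p v +
       wedge (theta 0 (tau 2%:R) (tau 3%:R)) (theta 1 (tau 0) (tau 1)) p v).

(* The cochain TE03 + TE12. *)
Definition TE : @cochain R 4 :=
  fun q r =>
    match q, r return form (ambPG R 4 q) r with
    | 0%N, 3%N => TE03
    | 1%N, 2%N => TE12
    | _, r' => zero_form r'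
    end.

End EulerClass.

Arguments PfOmega {R} q.
Arguments TPf {R} q.
Arguments TE {R} q r.

(* Main.v *)
Require Import Defs.
From mathcomp Require Import all_boot all_order all_algebra all_fingroup.
From mathcomp Require Import all_classical all_reals all_analysis.
From mathcomp Require Import ring lra zify.

(** All the forms of the statement are left-invariant under SO(4)^(q+1), so the
    statement is about Lie algebra cochains, and there it is a consequence of
    the invariance of the Pfaffian.

    Exterior derivative. The differential of a form on a submanifold S is that
    of any smooth extension. That the choice does not matter
    ([ext_diff_open_ext]) is Koszul's argument: the difference w of two
    extensions vanishes on vectors tangent to S, tangent vectors extend to
    affine vector fields tangent to S, and the derivatives of w are thereby
    expressed by values of w on brackets of such fields, which are tangent as
    well. For powers of the rotation group the fields are the left-invariant
    ones, and the tangent vectors at p are the p A with A skew, the curves being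
    given by the Cayley transform ([tangent_PG], [tangent_PG_skew]). A
    left-invariant form extends polynomially, with transposes in place of
    inverses, and its differential is the left-invariant form of the
    Chevalley-Eilenberg differential ([ext_diff_inv_form]).

    Fibre integrals. On tangent vectors the curvature of the simplicial
    connection is
      dt_i /\ theta_i - t_i theta_i /\ theta_i + theta /\ theta,
    which vanishes on two directions of the simplex. Hence the integrands are
    polynomials in t, nonzero only for q = 0, 1 in the case of TPf and for
    q = 1, 2 in the case of Pf(Omega). With P = Pf, a_i the values of theta_i
    and d = a_1 - a_0, integration gives, up to the constants of the statement,
      P(a_0, [a_0, a_0]) on PG(0) and P(a_0, a_1) on PG(1) for TPf,
      P(d, [d, d]) on PG(1) and P(a_1 - a_0, a_2 - a_0) on PG(2) for Pf(Omega)
    ([I_Delta_TPf03], [I_Delta_TPf12], [I_Delta_PfOmega13],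
    [I_Delta_PfOmega22]).

    Cochains. By invariance, P([X, A], B) + P(A, [X, B]) = 0, the trilinear form
    P(A, [B, C]) is totally antisymmetric and invariant. So its differential is
    0, the expansion of P(d, [d, d]) consists of the two pure terms coming from
    d' and the mixed terms coming from the differential of P(a_0, a_1)
    ([pfaff_component13]), and the alternating sum of the P(a_i, a_j) over the
    faces of a triangle is P(a_1 - a_0, a_2 - a_0) ([pfaff_component22]). The
    cocycle condition for Pf(Omega) is checked in the same way
    ([lie_diff_pfaff3_sub], [pfaff_cocycle23], [pfaff_cocycle32]). *)

Set Implicit Arguments.
Unset Strict Implicit.
Unset Printing Implicit Defensive.

Import Order.TTheory GRing.Theory Num.Theory.
Import numFieldNormedType.Exports.

Local Open Scope classical_set_scope.
Local Open Scope ring_scope.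

(* Differential forms, not bilinear ones. *)
Local Notation form := Defs.form.

(** * Alternating multilinear forms *)

Section AlternatingForms.
Context {R : realType} {V : normedModType R}.

Definition upd r (v : 'I_r -> V) (i : 'I_r) (x : V) : 'I_r -> V :=
  [eta v with i |-> x].

Lemma updE r (v : 'I_r -> V) i x j : upd v i x j = if j == i then x else v j.
Proof. by []. Qed.

Lemma upd_same r (v : 'I_r -> V) i : upd v i (v i) = v.
Proof. by apply: funext => j; rewrite updE; case: eqP => [->|]. Qed.

Lemma upd_twice r (v : 'I_r -> V) i x y : upd (upd v i x) i y = upd v i y.
Proof. by apply: funext => j; rewrite !updE; case: eqP. Qed.

Lemma upd_comm r (v : 'I_r -> V) i j x y : i != j ->
  upd (upd v i x) j y = upd (upd v j y) i x.
Proof.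
move=> ij; apply: funext => k; rewrite !updE.
by case: (eqVneq k j) => [->|//]; rewrite eq_sym (negbTE ij).
Qed.

Section Multilinear.
Variables (r : nat) (a : ('I_r -> V) -> R).
Hypothesis aL : multilinear_form a.

Lemma multilinearD v i x y : a (upd v i (x + y)) = a (upd v i x) + a (upd v i y).
Proof. by have := aL v i 1 x y; rewrite scale1r mul1r. Qed.

Lemma multilinear0 v i : a (upd v i 0) = 0.
Proof. by apply: (addrI (a (upd v i 0))); rewrite -multilinearD !addr0. Qed.

Lemma multilinearZ v i k x : a (upd v i (k *: x)) = k * a (upd v i x).
Proof. by rewrite -[k *: x]addr0 [LHS]aL [X in _ + X]multilinear0 addr0. Qed.

Lemma multilinearN v i x : a (upd v i (- x)) = - a (upd v i x).
Proof. by rewrite -scaleN1r multilinearZ mulN1r. Qed.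

Lemma multilinearB v i x y : a (upd v i (x - y)) = a (upd v i x) - a (upd v i y).
Proof. by rewrite multilinearD multilinearN. Qed.

Lemma multilinear_sum (I : finType) v i (F : I -> V) :
  a (upd v i (\sum_k F k)) = \sum_k a (upd v i (F k)).
Proof.
elim/big_ind2 : _ => [|x y z t <- <-|//]; [exact: multilinear0|].
by rewrite multilinearD.
Qed.

Hypothesis aA : alternating_form a.

Lemma alternating_tperm v i j : i != j -> a (v \o tperm i j) = - a v.
Proof.
move=> ij; pose u x y := upd (upd v i x) j y.
have uu x : a (u x x) = 0.
  by apply: (aA ij); rewrite /u !updE eqxx (negbTE ij) eqxx.
have uD x y z : a (u (x + y) z) = a (u x z) + a (u y z).
  by rewrite /u !(upd_comm _ _ _ ij) multilinearD.
have uD' x y z : a (u x (y + z)) = a (u x y) + a (u x z).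
  by rewrite /u multilinearD.
have := uu (v i + v j); rewrite uD !uD' !uu add0r addr0 => /eqP.
rewrite addr_eq0 => /eqP H.
have -> : v \o tperm i j = u (v j) (v i).
  apply: funext => k; rewrite /u !updE /=.
  by case: tpermP => [->|->|/eqP/negbTE-> /eqP/negbTE->//];
     rewrite ?eqxx ?(negbTE ij).
have uv : u (v i) (v j) = v.
  by rewrite /u (upd_comm _ _ _ ij) upd_same upd_same.
by rewrite -[in RHS]uv H opprK.
Qed.

Lemma alternating_perm (s : 'S_r) v : a (v \o s) = (-1) ^+ s * a v.
Proof.
have [ts -> {s} Hts] := prod_tpermP s.
elim: ts Hts v => [|[i j] ts IH] /=.
  move=> _ v; rewrite big_nil odd_perm1 mul1r; congr a.
  by apply: funext => k /=; rewrite perm1.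
case/andP=> ij /IH{}IH v; rewrite big_cons odd_mul_tperm ij signr_addb.
have -> : v \o (tperm i j * \prod_(j <- ts) tperm j.1 j.2)%g
   = (v \o (\prod_(j <- ts) tperm j.1 j.2)%g) \o tperm i j.
  by apply: funext => k; rewrite /= permM.
by rewrite alternating_tperm // IH /= expr1 mulN1r mulNr.
Qed.

End Multilinear.

(** The transposition of i and k fixes v, and on the remaining indices it
    carries the family omitting i to a permutation of the family omitting k;
    the sign of that permutation is -(-1)^(i+k). *)
Lemma alternating_omit r (a : ('I_r -> V) -> R) (v : 'I_r.+1 -> V) i k :
  multilinear_form a -> alternating_form a -> i != k -> v i = v k ->
  (-1) ^+ i * a (v \o lift i) = - ((-1) ^+ k * a (v \o lift k)).
Proof.
move=> aL aA ik vik.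
pose f j := odflt j (unlift k (tperm i k (lift i j))).
have fE j : lift k (f j) = tperm i k (lift i j).
  rewrite /f; case: unliftP => [j' -> //|] /= /(congr1 (tperm i k)).
  by rewrite tpermK tpermR => /eqP; rewrite eq_sym (negbTE (neq_lift _ _)).
have finj : injective f.
  move=> x y /(congr1 (lift k)); rewrite !fE => /perm_inj; exact: lift_inj.
have H : tperm i k = lift_perm i k (perm finj).
  apply/permP => x; case: (unliftP i x) => [j ->|->].
    by rewrite lift_perm_lift (permE finj) fE.
  by rewrite tpermL lift_perm_id.
have vt x : v (tperm i k x) = v x by case: tpermP => [->|->|].
have -> : v \o lift i = (v \o lift k) \o perm finj.
  by apply: funext => j /=; rewrite (permE finj) fE vt.
rewrite alternating_perm //.
have := congr1 (fun s : 'S_r.+1 => (-1) ^+ s : R) H.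
rewrite odd_tperm ik odd_lift_perm signr_addb (signr_addb _ (odd i)).
rewrite (signr_odd _ i) (signr_odd _ k) /= expr1 => E.
have kk : (-1) ^+ k * (-1) ^+ k = 1 :> R by rewrite -expr2 sqrr_sign.
rewrite mulrA -mulNr; congr (_ * _).
transitivity ((-1) ^+ i * (-1) ^+ perm finj * ((-1) ^+ k * (-1) ^+ k) : R).
  by rewrite kk mulr1.
by rewrite -[RHS]mulN1r [X in _ = X * _]E -!mulrA; congr (_ * _); rewrite mulrCA.
Qed.

(** The combinatorics behind the two occurrences of second derivatives in a
    differential: B i k stands for the derivative of the k-th vector field
    along the i-th one, and the terms of (i, k) and (k, i) differ by a bracket
    B i k - B k i, which lies in the space T where the form vanishes. *)
Lemma alternating_pairs r (a : ('I_r -> V) -> R) (T : V -> Prop)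
    (v : 'I_r.+1 -> V) (B : 'I_r.+1 -> 'I_r.+1 -> V) :
  multilinear_form a -> alternating_form a ->
  (forall u, (forall j, T (u j)) -> a u = 0) ->
  (forall i, T (v i)) -> (forall i k, T (B i k - B k i)) ->
  \sum_(i < r.+1) (-1) ^+ i *
    \sum_(j < r) a (upd (v \o lift i) j (B i (lift i j))) = 0.
Proof.
move=> aL aA aT Tv TB.
(* G i k is the term where the entry k is replaced and the entry i omitted. *)
pose G (i k : 'I_r.+1) : R := if i == k then 0
  else (-1) ^+ i * a (upd v k (B i k) \o lift i).
have upd_lift i j x : upd (v \o lift i) j x = upd v (lift i j) x \o lift i.
  by apply: funext => l; rewrite /= !updE (inj_eq (@lift_inj _ _)).
have GG i k : G i k + G k i = 0.
  rewrite /G eq_sym; case: (eqVneq k i) => [_|ki]; first by rewrite addr0.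
  have upd_omit (p q : 'I_r.+1) x y : p != q -> upd v p x \o lift q =
      upd (upd v p x) q y \o lift q.
    move=> pq; apply: funext => l; rewrite /= [RHS]updE.
    by rewrite eq_sym (negbTE (neq_lift _ _)).
  rewrite [upd v i _ \o _](upd_omit _ _ _ (B k i)) 1?eq_sym//.
  rewrite (alternating_omit aL aA ki); last first.
    by rewrite !updE !eqxx; case: ifP.
  rewrite -(upd_comm _ _ _ ki) -upd_omit //.
  case: (unliftP i k) ki => [j ->|->]; last by rewrite eqxx.
  move=> _; rewrite -!upd_lift -mulrBr -multilinearB // aT ?mulr0 //.
  by move=> l; rewrite updE; case: ifP => _; [exact: TB|exact: Tv].
have -> : \sum_(i < r.+1) (-1) ^+ i *
    \sum_(j < r) a (upd (v \o lift i) j (B i (lift i j))) =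
    \sum_i \sum_k G i k.
  apply: eq_bigr => i _; rewrite (bigD1_ord i) //= {1}/G eqxx add0r mulr_sumr.
  by apply: eq_bigr => j _; rewrite /G (negbTE (neq_lift _ _)) upd_lift.
have E : \sum_i \sum_k G i k = - \sum_i \sum_k G i k.
  rewrite [RHS](congr1 -%R (exchange_big _ _ _ _ _ _)) /= -sumrN.
  apply: eq_bigr => i _; rewrite -sumrN; apply: eq_bigr => k _.
  by apply/eqP; rewrite -addr_eq0 GG.
by apply/eqP; rewrite -[_ == 0](mulrn_eq0 _ 2) mulr2n addr_eq0 {1}E.
Qed.

End AlternatingForms.

(** * Coordinates and the Leibniz rule *)

Section PointwiseDerivatives.
Context {R : realType} {V : normedModType R}.
Implicit Types (x v : V) (f g : V -> R).

Lemma is_derive_add x v f g df dg : is_derive x v f df -> is_derive x v g dg ->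
  is_derive x v (fun y => f y + g y) (df + dg).
Proof. by move=> hf hg; apply: is_deriveD. Qed.

Lemma is_derive_mul x v f g df dg : is_derive x v f df -> is_derive x v g dg ->
  is_derive x v (fun y => f y * g y) (f x * dg + df * g x).
Proof.
move=> hf hg; apply: (is_derive_eq (is_deriveM hf hg)).
by rewrite [RHS]addrC [X in _ = X + _]mulrC addrC.
Qed.

Lemma is_derive_scale x v (k : R) f df : is_derive x v f df ->
  is_derive x v (fun y => k * f y) (k * df).
Proof. by move=> hf; apply: is_deriveZ. Qed.

Lemma is_derive_bigsum (I : Type) (s : seq I) (P : pred I) x v
    (f : I -> V -> R) (df : I -> R) :
  (forall i, is_derive x v (f i) (df i)) ->
  is_derive x v (fun y => \sum_(i <- s | P i) f i y) (\sum_(i <- s | P i) df i).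
Proof.
move=> hf; elim: s => [|i s IH].
  rewrite big_nil; under eq_fun do rewrite big_nil; exact: is_derive_cst.
rewrite big_cons; under eq_fun do rewrite big_cons.
by case: (P i) => //; apply: is_derive_add.
Qed.

End PointwiseDerivatives.

(** The difference quotient of a linear map along a line is constant. *)
Lemma is_derive_linear (R : realType) (V W : normedModType R) (f : V -> W)
    (x v : V) : (forall c y z, f (c *: y + z) = c *: f y + f z) ->
  is_derive x v f (f v).
Proof.
move=> flin.
have H : h^-1 *: (f (h *: v + x) - f x) @[h --> (0 : R)^'] --> f v.
  apply: (@cvg_trans _ (cst (f v) h @[h --> (0 : R)^'])); last exact: cvg_cst.
  apply: near_eq_cvg; near=> h => /=.
  rewrite flin addrK scalerA mulVf ?scale1r //.
  by near: h; exact: nbhs_dnbhs_neq.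
apply: DeriveDef; first by apply/cvg_ex; exists (f v).
by apply: cvg_lim.
Unshelve. all: by end_near. Qed.

(** A finite basis with differentiable coordinate functions. Expanding the
    arguments of a multilinear form in it reduces derivatives in the arguments
    to derivatives of scalars. *)
Record coordinates (R : realType) (E : normedModType R) := Coordinates {
  coord_index : finType;
  coord_vec : coord_index -> E;
  coord_fun : coord_index -> E -> R;
  coord_expand : forall x, \sum_k coord_fun k x *: coord_vec k = x;
  coord_linear : forall k c x y,
    coord_fun k (c *: x + y) = c * coord_fun k x + coord_fun k y;
  coord_differentiable : forall k x, differentiable (coord_fun k) x }.

Section Coordinates.
Context {R : realType} {E : normedModType R} (C : coordinates E).
Local Notation xi := (@coord_fun R E C).
Local Notation e := (@coord_vec R E C).

Lemma coordD k x y : xi k (x + y) = xi k x + xi k y.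
Proof. by have := coord_linear k 1 x y; rewrite scale1r mul1r. Qed.

Lemma coord0 k : xi k 0 = 0.
Proof. by apply: (addrI (xi k 0)); rewrite -coordD !addr0. Qed.

Lemma coordZ k c x : xi k (c *: x) = c * xi k x.
Proof. by rewrite -[c *: x]addr0 coord_linear coord0 addr0. Qed.

Lemma is_derive_coord k x v : is_derive x v (xi k) (xi k v).
Proof. by apply: is_derive_linear => c y z; exact: coord_linear. Qed.

Lemma multilinear_expand r (a : ('I_r -> E) -> R) u i x : multilinear_form a ->
  a (upd u i x) = \sum_k xi k x * a (upd u i (e k)).
Proof.
move=> aL; rewrite -{1}(coord_expand C x) multilinear_sum //.
by apply: eq_bigr => k _; rewrite multilinearZ.
Qed.

(** Leibniz rule for a multilinear form and its arguments all depending on a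
    real parameter. The arguments are released one slot at a time: a slot that
    starts to move is expanded in coordinates, which leaves products of a
    scalar function with an instance of the previous case. *)
Lemma is_derive_multilinear r (a : R -> ('I_r -> E) -> R) (a' : ('I_r -> E) -> R)
    (Z : 'I_r -> R -> E) (Y : 'I_r -> E) :
  (forall s, multilinear_form (a s)) ->
  (forall u, is_derive (0 : R) (1 : R) (fun s => a s u) (a' u)) ->
  (forall k j, is_derive (0 : R) (1 : R) (fun s => xi k (Z j s)) (xi k (Y j))) ->
  is_derive (0 : R) (1 : R) (fun s => a s (fun j => Z j s))
    (a' (fun j => Z j 0) + \sum_j a 0 (upd (fun j => Z j 0) j (Y j))).
Proof.
move=> aL a'P ZP.
have a'L : multilinear_form a'.
  move=> v i c x y; rewrite -!/(upd _ _ _).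
  have H := a'P (upd v i (c *: x + y)).
  rewrite -(@derive_val _ _ _ _ _ _ _ H); apply: derive_val.
  under eq_fun => s do rewrite [a s _](aL s).
  exact: (is_derive_add (is_derive_scale c (a'P _)) (a'P _)).
(* The first m arguments move with s; the others are frozen at u. *)
pose mix m s (u : 'I_r -> E) := fun j : 'I_r => if (j < m)%N then Z j s else u j.
have key m u : (m <= r)%N ->
    is_derive (0 : R) (1 : R) (fun s => a s (mix m s u))
    (a' (mix m 0 u) + \sum_(j < r | (j < m)%N) a 0 (upd (mix m 0 u) j (Y j))).
  elim: m u => [|m IH] u mr.
    have mix0 s : mix 0%N s u = u by apply: funext.
    rewrite big_pred0 // addr0 mix0; under eq_fun => s do rewrite mix0.
    exact: a'P.
  pose o := Ordinal mr.
  have mixS s : mix m.+1 s u = upd (mix m s u) o (Z o s).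
    apply: funext => j; rewrite updE /mix ltnS leq_eqVlt -val_eqE /=.
    by case: eqP => //= jm; congr (Z _ s); apply: val_inj.
  have mixU s x : mix m s (upd u o x) = upd (mix m s u) o x.
    apply: funext => j; rewrite !updE /mix -val_eqE /= updE -val_eqE /=.
    by case: (eqVneq (j : nat) m) => // ->; rewrite ltnn.
  under eq_fun => s do rewrite mixS (multilinear_expand _ _ _ (aL s)).
  apply: is_derive_eq.
    apply: is_derive_bigsum => k; apply: (is_derive_mul (ZP k o)).
    by under eq_fun => s do rewrite -mixU; apply: (IH _ (ltnW mr)).
  rewrite /= mixS (multilinear_expand _ _ _ a'L).
  under eq_bigr => k _ do rewrite mixU mulrDr -addrA.
  rewrite big_split; congr (_ + _).
  rewrite [RHS](bigD1 o) //= upd_twice (multilinear_expand _ _ (Y o)) //.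
  rewrite big_split /= addrC; congr (_ + _).
  under eq_bigr => k _ do rewrite mulr_sumr.
  rewrite exchange_big /=; apply: eq_big => [j|j jm].
    by rewrite ltnS ltn_neqAle andbC -val_eqE.
  have oj : o != j by rewrite -val_eqE /= neq_ltn jm orbT.
  rewrite (upd_comm _ _ _ oj) (multilinear_expand _ _ (Z o 0)) //.
  by apply: eq_bigr => k _; rewrite (upd_comm _ _ _ oj).
have mixr s u : mix r s u = fun j => Z j s.
  by apply: funext => j; rewrite /mix ltn_ord.
have := key r (fun=> 0) (leqnn r); under eq_fun => s do rewrite mixr.
rewrite mixr; under eq_bigl => j do rewrite ltn_ord.
by [].
Qed.

End Coordinates.

(** * The exterior derivative along a submanifold *)

Section ExteriorDerivative.
Context {R : realType} {V : normedModType R}.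
Implicit Types (S : set V) (p v : V).

(** Where the curve leaves S it is replaced by the constant p, which does not
    change its germ at 0. *)
Lemma tangent_curve S p v : S p -> tangent S p v ->
  exists c : R -> V,
    [/\ c 0 = p, forall s, S (c s) & is_derive (0 : R) (1 : R) c v].
Proof.
move=> Sp [c [c0 Sc dc]]; exists (fun s => if `[< S (c s) >] then c s else p).
split=> [|s|].
- by rewrite c0; case: asboolP.
- by case: asboolP.
- apply: near_eq_is_derive dc; near=> s.
  by case: asboolP => //; case; near: s.
Unshelve. all: by end_near. Qed.

Lemma is_derive_along (f : V -> R) (c : R -> V) p v :
  differentiable f p -> c 0 = p -> is_derive (0 : R) (1 : R) c v ->
  is_derive (0 : R) (1 : R) (fun s => f (c s)) ('D_v f p).
Proof.
move=> df c0 dc; rewrite -c0 in df *.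
have dc' : differentiable c 0 by apply/derivable1_diffP; case: dc.
have dfc : differentiable (f \o c) 0 by exact: differentiable_comp.
apply: DeriveDef; first exact/derivable1_diffP.
rewrite deriveE // diff_comp //= deriveE //; congr ('d f _ _).
by rewrite -deriveE // derive_val.
Qed.

(** Affine vector fields tangent to S through every tangent vector of S, as
    provided by the left-invariant fields of a matrix group. The derivative of
    an affine field is the constant map [field_lin p v], so the last condition
    says that the bracket of two of them is tangent to S. *)
Record affine_fields S := AffineFields {
  field_lin : V -> V -> V -> V;
  field_linear : forall p v k x y,
    field_lin p v (k *: x + y) = k *: field_lin p v x + field_lin p v y;
  field_tangent : forall p v x, S p -> tangent S p v -> S x ->
    tangent S x (v + field_lin p v (x - p));
  field_bracket : forall p v w, S p -> tangent S p v -> tangent S p w ->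
    tangent S p (field_lin p w v - field_lin p v w) }.

Section Uniqueness.
Variables (C : coordinates V) (S : set V) (F : affine_fields S).
Local Notation L := (field_lin F).

Lemma is_derive_linear_coord (M : V -> V) k (c : R -> V) v :
  (forall t x y, M (t *: x + y) = t *: M x + M y) ->
  is_derive (0 : R) (1 : R) c v ->
  is_derive (0 : R) (1 : R) (fun s => @coord_fun R V C k (M (c s)))
    (coord_fun k (M v)).
Proof.
move=> Mlin dc.
have M0 : M 0 = 0.
  by have := Mlin (-1) 0 0; rewrite scaler0 addr0 scaleN1r addNr.
have E x : coord_fun k (M x) =
    \sum_l coord_fun l x * coord_fun k (M (@coord_vec R V C l)).
  rewrite -{1}(coord_expand C x).
  rewrite (big_morph (fun y => coord_fun k (M y)) (id1 := 0) (op1 := +%R)).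
  - by apply: eq_bigr => l _; rewrite -[_ *: _]addr0 Mlin M0 addr0 coordZ.
  - by move=> y z; rewrite -[y in LHS]scale1r Mlin scale1r coordD.
  - by rewrite M0 coord0.
under eq_fun => s do rewrite E.
rewrite E; apply: is_derive_bigsum => l.
have dl := is_derive_along (coord_differentiable l (c 0)) erefl dc.
apply: (is_derive_eq (is_derive_mul dl
  (is_derive_cst (coord_fun k (M (@coord_vec R V C l))) _ _))).
by rewrite mulr0 add0r (@derive_val _ _ _ _ _ _ _ (is_derive_coord l _ _)).
Qed.

(** Koszul's argument. Extend the tangent vectors v_k at p to fields X_k as
    above. The function w(X_0, .., X_r), with X_i omitted, vanishes on S, so its
    derivative along v_i is 0; by the Leibniz rule the derivative of w on the
    frozen vectors is minus the sum of the terms in which some X_k is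
    differentiated along v_i. In the alternating sum over i these terms pair
    off into values of w on brackets, which vanish. *)
Lemma ext_diff_open_zero r (w : form V r) :
  (forall x, S x -> multilinear_form (w x) /\ alternating_form (w x)) ->
  (forall u x, S x -> differentiable (fun x => w x u) x) ->
  form_eq S w (zero_form r) ->
  form_eq S (ext_diff_open w) (zero_form r.+1).
Proof.
move=> wA wd w0 p v Sp Tv; rewrite /ext_diff_open /zero_form.
have [aL aA] := wA _ Sp.
have Lr q u x y : L q u (x + y) = L q u x + L q u y.
  by rewrite -[x in LHS]scale1r field_linear scale1r.
have L0 q u : L q u 0 = 0 by apply: (addrI (L q u 0)); rewrite -Lr !addr0.
pose B i k := L p (v k) (v i).
have key (i : 'I_r.+1) : 'D_(v i) (fun x => w x (fun j => v (lift i j))) p =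
    - \sum_(j < r) w p (upd (v \o lift i) j (B i (lift i j))).
  have [c [c0 Sc dc]] := tangent_curve Sp (Tv i).
  pose Z j s := v (lift i j) + L p (v (lift i j)) (c s - p).
  have ZE j : Z j 0 = v (lift i j) by rewrite /Z c0 subrr L0 addr0.
  have H : is_derive (0 : R) (1 : R) (fun s => w (c s) (fun j => Z j s))
      ('D_(v i) (fun x => w x (fun j => Z j 0)) p +
       \sum_j w (c 0) (upd (fun j => Z j 0) j (B i (lift i j)))).
    apply: (@is_derive_multilinear _ _ C _ (fun s => w (c s))
      (fun u => 'D_(v i) (w^~ u) p)) => [s|u|k j].
    - by have [] := wA _ (Sc s).
    - exact: is_derive_along (wd _ _ Sp) c0 dc.
    - rewrite /Z; under eq_fun do rewrite coordD.
      have dcp : is_derive (0 : R) (1 : R) (fun s => c s - p) (v i).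
        by apply: (is_derive_eq (is_deriveB dc (is_derive_cst p _ _))); rewrite subr0.
      have dk := is_derive_cst (coord_fun k (v (lift i j))) (0 : R) (1 : R).
      apply: (is_derive_eq (is_derive_add dk
        (is_derive_linear_coord k (field_linear F p (v (lift i j))) dcp))).
      by rewrite add0r.
  have H0 : (fun s => w (c s) (fun j => Z j s)) = cst 0.
    apply: funext => s; apply: w0 => // j.
    exact: field_tangent.
  have := @derive_val _ _ _ _ _ _ _ H; rewrite H0 derive_cst => /esym/eqP.
  rewrite addr_eq0 c0 => /eqP.
  have -> : (fun j => Z j 0) = v \o lift i by apply: funext => j; rewrite ZE.
  by [].
under eq_bigr => i _ do rewrite key mulrN.
rewrite sumrN (@alternating_pairs _ _ _ _ (tangent S p)) ?oppr0 //.
- by move=> u Tu; exact: w0.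
- by move=> i k; exact: field_bracket.
Qed.

Lemma smooth_differentiable U r (w : form V r) u x :
  smooth_form_on_open U w -> U x -> differentiable (fun x => w x u) x.
Proof. by move=> [_ ws] Ux; have [+ _] := ws u 1%N; apply. Qed.

(** The differential of an extension depends only on the restriction to S. *)
Lemma ext_diff_open_ext r (w1 w2 w1' w2' : form V r) :
  smooth_extension S w1 w1' -> smooth_extension S w2 w2' -> form_eq S w1 w2 ->
  form_eq S (ext_diff_open w1') (ext_diff_open w2').
Proof.
move=> [U1 [_ SU1 s1 e1]] [U2 [_ SU2 s2 e2]] e12.
pose w : form V r := fun x u => w1' x u - w2' x u.
have d1 u x : S x -> differentiable (w1'^~ u) x.
  by move=> Sx; exact: smooth_differentiable s1 (SU1 _ Sx).
have d2 u x : S x -> differentiable (w2'^~ u) x.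
  by move=> Sx; exact: smooth_differentiable s2 (SU2 _ Sx).
have w0 : form_eq S (ext_diff_open w) (zero_form r.+1).
  apply: ext_diff_open_zero.
  - move=> x Sx; have [[L1 A1] [L2 A2]] := (s1.1 _ (SU1 _ Sx), s2.1 _ (SU2 _ Sx)).
    split=> [u i k y z|u i j ij uij]; first by rewrite /w L1 L2; ring.
    by rewrite /w (A1 _ _ _ ij uij) (A2 _ _ _ ij uij) subrr.
  - by move=> u x Sx; apply: differentiableB; [exact: d1|exact: d2].
  - by move=> x u Sx Tu; rewrite /w e1 // e2 // e12 // subrr.
move=> p v Sp Tv; apply/eqP; rewrite -subr_eq0 -[X in _ == X](w0 p v Sp Tv).
rewrite -sumrB; apply/eqP/eq_bigr => i _; rewrite -mulrBr; congr (_ * _).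
by rewrite -deriveB //; apply: diff_derivable; [exact: d1|exact: d2].
Qed.

Lemma ext_diffE r (w w' : form V r) : smooth_extension S w w' ->
  form_eq S (ext_diff S w) (ext_diff_open w').
Proof.
move=> ww'; rewrite /ext_diff; case: pselect => [e|]; last by case; exists w'.
by apply: (ext_diff_open_ext (projT2 (cid e)) ww').
Qed.

End Uniqueness.

Lemma form_eq_sym S r (w1 w2 : form V r) : form_eq S w1 w2 -> form_eq S w2 w1.
Proof. by move=> e p v Sp Tv; rewrite e. Qed.

Lemma form_eq_trans S r (w2 w1 w3 : form V r) :
  form_eq S w1 w2 -> form_eq S w2 w3 -> form_eq S w1 w3.
Proof. by move=> e e' p v Sp Tv; rewrite e // e'. Qed.

End ExteriorDerivative.

(** * Tangent spaces of powers of the rotation group *)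

Section CurvesInCoordinates.
Context {R : realType}.

Lemma is_derive_coord_along (E : normedModType R) (C : coordinates E) k
    (c : R -> E) (v : E) : is_derive (0 : R) (1 : R) c v ->
  is_derive (0 : R) (1 : R) (fun s => @coord_fun R E C k (c s)) (coord_fun k v).
Proof.
move=> dc; rewrite -(@derive_val _ _ _ _ _ _ _ (is_derive_coord k (c 0) v)).
exact: is_derive_along (coord_differentiable k (c 0)) erefl dc.
Qed.

Lemma is_derive_from_coord (E : normedModType R) (C : coordinates E)
    (c : R -> E) (v : E) :
  (forall k, is_derive (0 : R) (1 : R) (fun s => @coord_fun R E C k (c s))
    (coord_fun k v)) ->
  is_derive (0 : R) (1 : R) c v.
Proof.
move=> dc; have -> : c = fun s => \sum_k coord_fun k (c s) *: @coord_vec R E C k.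
  by apply: funext => s; rewrite coord_expand.
rewrite -[in X in is_derive _ _ _ X](coord_expand C v).
elim: (index_enum _) => [|k l IH].
  rewrite big_nil; under eq_fun do rewrite big_nil; exact: is_derive_cst.
rewrite big_cons; under eq_fun do rewrite big_cons.
apply: is_deriveD; set f := fun s => coord_fun k (c s).
have df : differentiable f 0 by apply/derivable1_diffP; case: (dc k).
have dfk : differentiable (fun s => f s *: coord_vec k) 0.
  exact: differentiableZl.
apply: DeriveDef; first exact/derivable1_diffP.
rewrite deriveE // diffZl //; congr (_ *: _).
by rewrite -deriveE // derive_val.
Qed.

Lemma matrix_coord_expand m n (x : 'M[R]_(m, n)) :
  \sum_(k : 'I_m * 'I_n) x k.1 k.2 *: delta_mx k.1 k.2 = x.
Proof.
by rewrite -(pair_bigA _ (fun i j => x i j *: delta_mx i j)) -matrix_sum_delta.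
Qed.

Definition matrix_coordinates m n : coordinates 'M[R]_(m, n).
Proof.
apply: (@Coordinates R 'M[R]_(m, n) ('I_m * 'I_n)%type
  (fun k => delta_mx k.1 k.2) (fun k x => x k.1 k.2)).
- exact: matrix_coord_expand.
- by move=> k c x y; rewrite !mxE.
- by move=> k x; exact: differentiable_coord.
Defined.

Lemma differentiable_fst (V W : normedModType R) (x : (V * W)%type) :
  differentiable (fst : V * W -> V) x.
Proof. by apply: linear_differentiable => y; exact: cvg_fst. Qed.

Lemma differentiable_snd (V W : normedModType R) (x : (V * W)%type) :
  differentiable (snd : V * W -> W) x.
Proof. by apply: linear_differentiable => y; exact: cvg_snd. Qed.

Definition prod_coordinates (V W : normedModType R) (C : coordinates V)
  (D : coordinates W) : coordinates (V * W)%type.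
Proof.
apply: (@Coordinates R (V * W)%type (coord_index C + coord_index D)%type
  (fun k => match k with inl i => (coord_vec i, 0) | inr j => (0, coord_vec j) end)
  (fun k x => match k with inl i => coord_fun i x.1 | inr j => coord_fun j x.2 end)).
- move=> [x y]; rewrite big_sumType /=.
  have suml (s : seq (coord_index C)) : \sum_(i <- s) coord_fun i x *:
      ((coord_vec i, 0) : V * W) = (\sum_(i <- s) coord_fun i x *: coord_vec i, 0).
    elim: s => [|i s IH]; rewrite ?big_nil // !big_cons IH.
    by congr (_, _); rewrite /= scaler0 addr0.
  have sumr (s : seq (coord_index D)) : \sum_(i <- s) coord_fun i y *:
      ((0, coord_vec i) : V * W) = (0, \sum_(i <- s) coord_fun i y *: coord_vec i).
    elim: s => [|i s IH]; rewrite ?big_nil // !big_cons IH.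
    by congr (_, _); rewrite /= scaler0 addr0.
  rewrite suml sumr !coord_expand.
  by congr (_, _); rewrite ?addr0 ?add0r.
- by move=> [i|j] c x y; rewrite /= coord_linear.
- move=> [i|j] x; apply: (@differentiable_comp _ _ _ _ _ (coord_fun _)).
  + exact: differentiable_fst.
  + exact: coord_differentiable.
  + exact: differentiable_snd.
  + exact: coord_differentiable.
Defined.

End CurvesInCoordinates.

Section TangentSpaces.
Context {R : realType} {n q : nat}.
Local Notation G := (@SO R n).
Local Notation PGq := (ambPG R n q).

Definition skew (A : 'M[R]_n) : Prop := A^T = - A.

Definition mulPG (x a : PGq) : PGq := \matrix_i mxvec (pr i x *m pr i a).
(** Left translation of a vector at p to the identity, with transposes in place
    of inverses: the two agree on rotations, and this one is polynomial in p. *)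
Definition ltransPG (p v : PGq) : PGq := \matrix_i mxvec ((pr i p)^T *m pr i v).

Lemma pr_mulPG i x a : pr i (mulPG x a) = pr i x *m pr i a.
Proof. by rewrite {1}/pr rowK mxvecK. Qed.

Lemma pr_ltransPG i p v : pr i (ltransPG p v) = (pr i p)^T *m pr i v.
Proof. by rewrite {1}/pr rowK mxvecK. Qed.

Lemma pr_linear i k (x y : PGq) : pr i (k *: x + y) = k *: pr i x + pr i y.
Proof. by rewrite /pr !linearP. Qed.

Lemma prD i (x y : PGq) : pr i (x + y) = pr i x + pr i y.
Proof. by rewrite /pr !linearD. Qed.

Lemma prB i (x y : PGq) : pr i (x - y) = pr i x - pr i y.
Proof. by rewrite /pr !linearB. Qed.

Lemma prN i (x : PGq) : pr i (- x) = - pr i x.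
Proof. by rewrite /pr !linearN. Qed.

Lemma prZ i k (x : PGq) : pr i (k *: x) = k *: pr i x.
Proof. by rewrite /pr !linearZ. Qed.

Lemma pr_inj (x y : PGq) : (forall i, pr i x = pr i y) -> x = y.
Proof.
move=> xy; apply/row_matrixP => i.
by have := congr1 mxvec (xy i); rewrite /pr !vec_mxK.
Qed.

Lemma prE i (x : PGq) a b : pr i x a b = x i (mxvec_index a b).
Proof. by rewrite /pr !mxE. Qed.

Lemma SO_orth (g : 'M[R]_n) : G g -> g *m g^T = 1%:M.
Proof. by case=> /mulmx1C. Qed.

Lemma mulPGK p v : PG G p -> mulPG p (ltransPG p v) = v.
Proof.
move=> Gp; apply: pr_inj => i.
by rewrite pr_mulPG pr_ltransPG mulmxA SO_orth ?mul1mx //; exact: Gp.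
Qed.

(** The Cayley transform of s A / 2 is a curve of rotations with velocity A. *)
Definition cayley (A : 'M[R]_n) (s : R) : 'M[R]_n :=
  let M := 1%:M - (s / 2) *: A in M^T *m invmx M.

Lemma cayley_SO A s : skew A -> 1%:M - (s / 2) *: A \in unitmx ->
  G (cayley A s).
Proof.
rewrite /skew /cayley; set M := _ - _ => sA Mu.
have MT : M^T = 1%:M + (s / 2) *: A.
  by rewrite linearB linearZ /= trmx1 sA scalerN opprK.
have MC : M^T *m M = M *m M^T.
  rewrite MT /M mulmxBr mulmxDr !mulmx1 mulmxDl mulmxBl !mul1mx.
  by rewrite opprD !addrA addrK subrK.
split.
  rewrite trmx_mul trmxK trmx_inv mulmxA -[_ *m M *m _]mulmxA -MC mulmxA.
  by rewrite mulVmx ?unitmx_tr // mul1mx mulmxV.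
by rewrite det_mulmx det_tr det_inv mulrV.
Qed.

(** The denominator of the Cayley transform as a matrix of polynomials in s: its
    inverse then has rational entries, with denominator 1 at s = 0. *)
Definition cayley_poly (A : 'M[R]_n) : 'M[{poly R}]_n :=
  1%:M - 'X *: map_mx (fun x => (x / 2)%:P) A.

Lemma cayley_polyE A s :
  map_mx (horner_eval s) (cayley_poly A) = 1%:M - (s / 2) *: A.
Proof.
apply/matrixP => i j; rewrite !mxE /horner_eval !hornerE.
by case: (i == j); rewrite !hornerE /= mulrAC.
Qed.

Lemma cayley_det A s : \det (1%:M - (s / 2) *: A) = (\det (cayley_poly A)).[s].
Proof. by rewrite -cayley_polyE det_map_mx. Qed.

Lemma cayley_det0 A : (\det (cayley_poly A)).[0] = 1.
Proof. by rewrite -cayley_det mul0r scale0r subr0 det1. Qed.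

Lemma cayley_unit (A : 'M[R]_n) : \forall s \near (0 : R), 1%:M - (s / 2) *: A \in unitmx.
Proof.
near=> s; rewrite unitmxE unitfE cayley_det; near: s.
apply: (cvgr_neq0 (\det (cayley_poly A)).[0]); first exact: continuous_horner.
by rewrite cayley_det0 oner_eq0.
Unshelve. all: by end_near. Qed.

(** The transform is 1 + s A M^-1 with M = 1 - (s/2) A, and M is 1 at s = 0. *)
Lemma cayley_derive A a b : skew A ->
  is_derive (0 : R) (1 : R) (fun s => cayley A s a b) (A a b).
Proof.
move=> sA; set P := cayley_poly A; set d := \det P.
pose g s := \sum_k A a k * ((\adj P k b).[s] * (d.[s])^-1).
have adjE s k : (\adj P k b).[s] = \adj (1%:M - (s / 2) *: A) k b.
  by rewrite -cayley_polyE -map_mx_adj [RHS]mxE.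
have g0 : g 0 = A a b.
  rewrite /g cayley_det0 invr1.
  under eq_bigr => k _ do rewrite mulr1 adjE mul0r scale0r subr0.
  have -> : \adj 1%:M = 1%:M :> 'M[R]_n.
    by have := mul_mx_adj (1%:M : 'M[R]_n); rewrite mul1mx det1.
  by have := congr1 (fun M : 'M[R]_n => M a b) (mulmx1 A); rewrite mxE.
have dinv : derivable (fun s => (d.[s])^-1) 0 (1 : R).
  by apply: derivableV; rewrite ?cayley_det0 ?oner_eq0 //; case: (is_derive_poly d 0).
have dg := is_derive_bigsum (index_enum 'I_n) xpredT (fun k =>
  is_derive_scale (A a k) (is_derive_mul (is_derive_poly (\adj P k b) 0)
    (derivableP dinv))).
have H := is_derive_add (is_derive_cst ((1%:M : 'M[R]_n) a b) (0 : R) (1 : R))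
  (is_derive_mul (is_derive_id (0 : R) 1) dg).
rewrite /= mul0r add0r add0r mul1r in H.
rewrite -g0; apply: near_eq_is_derive H; near=> s.
have Mu : 1%:M - (s / 2) *: A \in unitmx by near: s; exact: cayley_unit.
rewrite /cayley; set M := 1%:M - _ in Mu *.
have -> : M^T = M + s *: A.
  rewrite /M linearB linearZ /= trmx1 sA scalerN opprK -addrA; congr (_ + _).
  by rewrite [X in _ + X](_ : _ = (s / 2) *: A + (s / 2) *: A)
    ?addKr // -scalerDl -splitr.
rewrite mulmxDl mulmxV // -scalemxAl !mxE; congr (_ + _ * _).
apply: eq_bigr => k _; congr (_ * _).
by rewrite /invmx Mu [RHS]mxE mulrC adjE -cayley_det.
Unshelve. all: by end_near. Qed.

End TangentSpaces.

Section TangentBundles.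
Context {R : realType} {n q : nat}.
Local Notation G := (@SO R n).
Local Notation PGq := (ambPG R n q).
Local Notation DPGq := (ambDPG R n q).

Definition PG_coordinates : coordinates PGq := matrix_coordinates q.+1 (n * n).
Definition DPG_coordinates : coordinates DPGq :=
  prod_coordinates (matrix_coordinates 1 q.+1) PG_coordinates.

(** Differentiate the orthogonality relation along a curve. *)
Lemma tangent_PG_skew (p v : PGq) i : PG G p -> tangent (PG G (q := q)) p v ->
  skew (pr i (ltransPG p v)).
Proof.
move=> Gp /(tangent_curve Gp)[c [c0 Gc dc]].
have dpr a b : is_derive (0 : R) (1 : R) (fun s => pr i (c s) a b) (pr i v a b).
  under eq_fun do rewrite prE; rewrite prE.
  exact: (is_derive_coord_along (C := PG_coordinates) (i, mxvec_index a b) dc).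
apply/matrixP => a b; rewrite pr_ltransPG trmx_mul trmxK [RHS]mxE.
apply/eqP; rewrite -addr_eq0; apply/eqP.
have H : is_derive (0 : R) (1 : R)
    (fun s => \sum_k pr i (c s) k a * pr i (c s) k b)
    (\sum_k (pr i (c 0) k a * pr i v k b + pr i v k a * pr i (c 0) k b)).
  by apply: is_derive_bigsum => k; exact: is_derive_mul (dpr k a) (dpr k b).
have E : (fun s => \sum_k pr i (c s) k a * pr i (c s) k b) =
    cst ((1%:M : 'M[R]_n) a b).
  apply: funext => s /=; rewrite -(Gc s i).1 mxE.
  by apply: eq_bigr => k _; rewrite [_^T _ _]mxE.
have := @derive_val _ _ _ _ _ _ _ H; rewrite E derive_cst c0 => ->.
rewrite ![(_ *m _) _ _]mxE -big_split; apply: eq_bigr => k _ /=.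
by rewrite ![_^T _ _]mxE addrC.
Qed.

Lemma tangent_PG (p a : PGq) : PG G p -> (forall i, skew (pr i a)) ->
  tangent (PG G (q := q)) p (mulPG p a).
Proof.
move=> Gp sa.
exists (fun s => \matrix_i mxvec (pr i p *m cayley (pr i a) s)); split.
- apply: pr_inj => i; rewrite {1}/pr rowK mxvecK.
  by rewrite /cayley mul0r scale0r subr0 trmx1 invmx1 !mulmx1.
- near=> s; move=> i; rewrite {1}/pr rowK mxvecK.
  have : G (cayley (pr i a) s).
    apply: cayley_SO => //; move: i; near: s; apply: filter_forall => i.
    exact: cayley_unit.
  move=> [c1 c2]; have [p1 p2] := Gp i; split; last by rewrite det_mulmx p2 c2 mul1r.
  by rewrite trmx_mul mulmxA -[_ *m _ *m pr i p]mulmxA p1 mulmx1.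
- apply: (is_derive_from_coord (C := PG_coordinates)) => -[i l] /=.
  case/mxvec_indexP: l => b d.
  rewrite -prE pr_mulPG mxE; under eq_fun do rewrite mxE mxvecE mxE.
  apply: is_derive_bigsum => k; apply: is_derive_scale.
  exact: cayley_derive.
Unshelve. all: by end_near. Qed.

Lemma mulPGDl (x y a : PGq) : mulPG (x + y) a = mulPG x a + mulPG y a.
Proof. by apply: pr_inj => i; rewrite prD !pr_mulPG prD mulmxDl. Qed.

Lemma mulPGZl k (x a : PGq) : mulPG (k *: x) a = k *: mulPG x a.
Proof. by apply: pr_inj => i; rewrite prZ !pr_mulPG prZ scalemxAl. Qed.

Lemma mulPG_bracket (p v w : PGq) : PG G p ->
  mulPG v (ltransPG p w) - mulPG w (ltransPG p v) =
  mulPG p (mulPG (ltransPG p v) (ltransPG p w) -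
           mulPG (ltransPG p w) (ltransPG p v)).
Proof.
move=> Gp; apply: pr_inj => i.
rewrite pr_mulPG !prB !pr_mulPG mulmxBr !mulmxA.
by rewrite -!pr_mulPG !mulPGK.
Qed.

Lemma tangent_PG_bracket (p v w : PGq) : PG G p ->
  tangent (PG G (q := q)) p v -> tangent (PG G (q := q)) p w ->
  tangent (PG G (q := q)) p (mulPG v (ltransPG p w) - mulPG w (ltransPG p v)).
Proof.
move=> Gp Tv Tw; rewrite mulPG_bracket //; apply: tangent_PG => // i.
rewrite /skew prB !pr_mulPG linearB /= !trmx_mul.
rewrite !(tangent_PG_skew _ Gp Tv) !(tangent_PG_skew _ Gp Tw).
by rewrite !mulNmx !mulmxN !opprK opprB.
Qed.

(** The left-invariant fields x |-> x A; the bracket of the fields of A and B is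
    the field of the commutator of A and B. *)
Definition PG_fields : affine_fields (PG G (q := q)).
Proof.
apply: (@AffineFields _ _ _ (fun p v x => mulPG x (ltransPG p v))).
- by move=> p v k x y; rewrite mulPGDl mulPGZl.
- move=> p v x Gp Tv Gx; rewrite -{1}(mulPGK v Gp) -mulPGDl addrC subrK.
  by apply: tangent_PG => // i; exact: tangent_PG_skew.
- by move=> p v w Gp Tv Tw; exact: tangent_PG_bracket.
Defined.

Lemma tangent_DPG (x v : DPGq) : tangent (PG G (q := q)) x.2 v.2 ->
  \sum_i bary i x = 1 -> \sum_i v.1 0 i = 0 -> tangent (DPG G (q := q)) x v.
Proof.
move=> [c [c0 Gc dc]] x1 v0; exists (fun s => (x.1 + s *: v.1, c s)); split.
- by rewrite scale0r addr0 c0; case: x x1 c0.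
- near=> s; split; last by rewrite /toPG /=; near: s.
  transitivity (\sum_i bary i x + s * \sum_i v.1 0 i).
    rewrite mulr_sumr -big_split.
    by apply: eq_bigr => i _; rewrite /bary /= !mxE.
  by rewrite x1 v0 mulr0 addr0.
- apply: (is_derive_from_coord (C := DPG_coordinates)) => -[[i j]|k] /=.
    under eq_fun do rewrite !mxE.
    have := is_derive_add (is_derive_cst (x.1 i j) (0 : R) (1 : R))
      (is_derive_mul (is_derive_id (0 : R) 1) (is_derive_cst (v.1 i j) _ _)).
    by rewrite mulr0 !add0r mul1r.
  exact: (is_derive_coord_along (C := PG_coordinates) k dc).
Unshelve. all: by end_near. Qed.

Lemma tangent_DPG_inv (x v : DPGq) : DPG G x -> tangent (DPG G (q := q)) x v ->
  tangent (PG G (q := q)) x.2 v.2 /\ \sum_i v.1 0 i = 0.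
Proof.
move=> Gx /(tangent_curve Gx)[c [c0 Gc dc]]; split.
  exists (fun s => (c s).2); split; first by rewrite c0.
  - by near=> s; case: (Gc s).
  - apply: (is_derive_from_coord (C := PG_coordinates)) => k.
    exact: (is_derive_coord_along (C := DPG_coordinates) (inr k) dc).
have H := is_derive_bigsum (index_enum 'I_q.+1) xpredT (fun i =>
  is_derive_coord_along (C := DPG_coordinates) (inl (0, i)) dc).
rewrite -[LHS](@derive_val _ _ _ _ _ _ _ H) /=.
rewrite (_ : (fun _ => _) = cst 1) ?derive_cst //.
by apply: funext => s; case: (Gc s).
Unshelve. all: by end_near. Qed.

(** Constant along the simplex and left-invariant along the group. *)
Definition DPG_fields : affine_fields (DPG G (q := q)).
Proof.
apply: (@AffineFields _ _ _ (fun p v x => (0, mulPG x.2 (ltransPG p.2 v.2)) : DPGq)).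
- move=> p v k x y; rewrite mulPGDl mulPGZl.
  by congr (_, _); rewrite /= scaler0 addr0.
- move=> p v x Gp Tv Gx; have [Tv2 v0] := tangent_DPG_inv Gp Tv.
  apply: tangent_DPG => /=; last by rewrite addr0.
    exact: (field_tangent PG_fields Gp.2 Tv2 Gx.2).
  exact: Gx.1.
- move=> p v w Gp Tv Tw.
  have [Tv2 v0] := tangent_DPG_inv Gp Tv; have [Tw2 w0] := tangent_DPG_inv Gp Tw.
  apply: tangent_DPG => /=; first exact: (field_bracket PG_fields Gp.2 Tv2 Tw2).
    exact: Gp.1.
  by rewrite subrr; apply: big1 => i _; rewrite mxE.
Defined.

End TangentBundles.

(** * Smooth functions and left-invariant forms *)

Section SmoothFunctions.
Context {R : realType} {V : normedModType R}.
Implicit Types (f g : V -> R) (U : set V).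

Lemma CkW k U f : Ck k.+1 U f -> Ck k U f.
Proof.
elim: k f => [|k IH] f [df Df].
  by move=> x Ux; apply: differentiable_continuous; exact: df.
by split=> // v; exact: IH.
Qed.

Lemma Ck_cst k (c : R) : Ck k [set: V] (fun=> c).
Proof.
elim: k c => [|k IH] c; first by move=> x _; exact: cst_continuous.
split=> [x _|v]; first exact: differentiable_cst.
rewrite (_ : 'D_v _ = fun=> 0) //.
by apply: funext => x; exact: derive_cst.
Qed.

Lemma Ck_add k f g : Ck k [set: V] f -> Ck k [set: V] g ->
  Ck k [set: V] (fun x => f x + g x).
Proof.
elim: k f g => [|k IH] f g.
  by move=> cf cg x Ux; apply: cvgD; [exact: cf|exact: cg].
move=> [df Df] [dg Dg]; split=> [x Ux|v].
  by apply: differentiableD; [exact: df|exact: dg].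
rewrite (_ : 'D_v _ = fun x => 'D_v f x + 'D_v g x).
  by apply: IH; [exact: Df|exact: Dg].
by apply: funext => x; apply: deriveD; apply: diff_derivable; [exact: df|exact: dg].
Qed.

Lemma Ck_mul k f g : Ck k [set: V] f -> Ck k [set: V] g ->
  Ck k [set: V] (fun x => f x * g x).
Proof.
elim: k f g => [|k IH] f g.
  by move=> cf cg x Ux; apply: cvgM; [exact: cf|exact: cg].
move=> Cf Cg; have [df Df] := Cf; have [dg Dg] := Cg; split=> [x Ux|v].
  by apply: differentiableM; [exact: df|exact: dg].
rewrite (_ : 'D_v _ = fun x => f x * 'D_v g x + g x * 'D_v f x).
  by apply: Ck_add; apply: IH; solve [exact: Df|exact: Dg|exact: CkW].
by apply: funext => x; apply: deriveM; apply: diff_derivable; [exact: df|exact: dg].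
Qed.

Lemma smooth_cst (c : R) : smooth [set: V] (fun=> c).
Proof. by move=> k; exact: Ck_cst. Qed.

Lemma smooth_add f g : smooth [set: V] f -> smooth [set: V] g ->
  smooth [set: V] (fun x => f x + g x).
Proof. by move=> sf sg k; exact: Ck_add. Qed.

Lemma smooth_mul f g : smooth [set: V] f -> smooth [set: V] g ->
  smooth [set: V] (fun x => f x * g x).
Proof. by move=> sf sg k; exact: Ck_mul. Qed.

Lemma smooth_bigsum (I : Type) (s : seq I) (P : pred I) (f : I -> V -> R) :
  (forall i, smooth [set: V] (f i)) ->
  smooth [set: V] (fun x => \sum_(i <- s | P i) f i x).
Proof.
move=> sf; elim: s => [|i s IH].
  by under eq_fun do rewrite big_nil; exact: smooth_cst.
under eq_fun do rewrite big_cons.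
by case: (P i) => //; apply: smooth_add.
Qed.

Lemma smooth_coord (C : coordinates V) k : smooth [set: V] (@coord_fun R V C k).
Proof.
case=> [|m].
  move=> x _; apply: differentiable_continuous; exact: coord_differentiable.
split=> [x _|v]; first exact: coord_differentiable.
rewrite (_ : 'D_v _ = fun=> coord_fun k v); first exact: Ck_cst.
by apply: funext => x; rewrite (@derive_val _ _ _ _ _ _ _ (is_derive_coord k x v)).
Qed.

Lemma smooth_linear (C : coordinates V) (L : V -> R) :
  (forall c x y, L (c *: x + y) = c * L x + L y) -> smooth [set: V] L.
Proof.
move=> Llin.
have L0 : L 0 = 0.
  by have := Llin (-1) 0 0; rewrite scaler0 addr0 mulN1r addNr.
have -> : L = fun x => \sum_k coord_fun k x * L (@coord_vec R V C k).
  apply: funext => x; rewrite -{1}(coord_expand C x).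
  rewrite (big_morph L (id1 := 0) (op1 := +%R)) //.
    by apply: eq_bigr => k _; rewrite -[_ *: _]addr0 Llin L0 addr0.
  by move=> y z; rewrite -[y in LHS]scale1r Llin mul1r.
apply: smooth_bigsum => k; apply: smooth_mul; last exact: smooth_cst.
exact: smooth_coord.
Qed.

Lemma smooth_multilinear (E : normedModType R) (C : coordinates E) r
    (a : ('I_r -> E) -> R) (Z : 'I_r -> V -> E) :
  multilinear_form a ->
  (forall k j, smooth [set: V] (fun x => @coord_fun R E C k (Z j x))) ->
  smooth [set: V] (fun x => a (fun j => Z j x)).
Proof.
move=> aL sZ.
pose mix m x (u : 'I_r -> E) := fun j : 'I_r => if (j < m)%N then Z j x else u j.
have key m u : (m <= r)%N -> smooth [set: V] (fun x => a (mix m x u)).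
  elim: m u => [|m IH] u mr.
    have mix0 x : mix 0%N x u = u by apply: funext.
    by under eq_fun do rewrite mix0; exact: smooth_cst.
  pose o := Ordinal mr.
  have mixS x : mix m.+1 x u = upd (mix m x u) o (Z o x).
    apply: funext => j; rewrite updE /mix ltnS leq_eqVlt -val_eqE /=.
    by case: eqP => //= jm; congr (Z _ x); apply: val_inj.
  have mixU x y : mix m x (upd u o y) = upd (mix m x u) o y.
    apply: funext => j; rewrite !updE /mix -val_eqE /= updE -val_eqE /=.
    by case: (eqVneq (j : nat) m) => // ->; rewrite ltnn.
  under eq_fun => x do rewrite mixS (multilinear_expand C _ _ _ aL).
  apply: smooth_bigsum => k; apply: smooth_mul; first exact: sZ.
  by under eq_fun => x do rewrite -mixU; apply: IH; exact: ltnW.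
have mixr x u : mix r x u = fun j => Z j x.
  by apply: funext => j; rewrite /mix ltn_ord.
by have := key r (fun=> 0) (leqnn r); under eq_fun => x do rewrite mixr.
Qed.

End SmoothFunctions.

Section InvariantForms.
Context {R : realType} {n q : nat}.
Local Notation G := (@SO R n).
Local Notation PGq := (ambPG R n q).
Implicit Types (p x y : PGq).

(** The left-invariant form with value W at the identity. *)
Definition inv_form r (W : ('I_r -> PGq) -> R) : form PGq r :=
  fun p v => W (fun k => ltransPG p (v k)).

(** The Chevalley-Eilenberg differential. It is usually written with values of W
    on commutators [A_i, A_k]; here their two products occur separately, in the
    terms that omit i and k respectively. *)
Definition lie_diff r (W : ('I_r -> PGq) -> R) (A : 'I_r.+1 -> PGq) : R :=
  \sum_(i < r.+1) (-1) ^+ i *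
    \sum_(j < r) W (upd (A \o lift i) j (- mulPG (A i) (A (lift i j)))).

Lemma ltransPG_linear p k (x y : PGq) :
  ltransPG p (k *: x + y) = k *: ltransPG p x + ltransPG p y.
Proof.
by apply: pr_inj => i; rewrite prD prZ !pr_ltransPG pr_linear mulmxDr scalemxAr.
Qed.

Lemma ltransPG_linearl (v : PGq) k x y :
  ltransPG (k *: x + y : PGq) v = k *: ltransPG x v + ltransPG y v.
Proof.
apply: pr_inj => i; rewrite prD prZ !pr_ltransPG pr_linear.
by rewrite linearD linearZ /= mulmxDl scalemxAl.
Qed.

Lemma ltransPG_upd p r (v : 'I_r -> PGq) i x :
  (fun k => ltransPG p (upd v i x k)) = upd (fun k => ltransPG p (v k)) i (ltransPG p x).
Proof. by apply: funext => k; rewrite !updE; case: ifP. Qed.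

Variables (r : nat) (W : ('I_r -> PGq) -> R).
Hypotheses (WL : multilinear_form W) (WA : alternating_form W).

Lemma inv_form_smooth : smooth_form_on_open [set: PGq] (inv_form W).
Proof.
split=> [p _|v]; first split.
- move=> v i k x y; rewrite /inv_form !ltransPG_upd ltransPG_linear.
  exact: WL.
- by move=> v i j ij vij; apply: (WA ij); rewrite vij.
apply: (smooth_multilinear (C := PG_coordinates)) => // k j.
apply: (smooth_linear PG_coordinates) => c x y.
by rewrite ltransPG_linearl coord_linear.
Qed.

Lemma ext_diff_open_inv_form p v :
  ext_diff_open (inv_form W) p v = \sum_(i < r.+1) (-1) ^+ i *
    \sum_(j < r) W (upd (fun j => ltransPG p (v (lift i j))) j
                        (ltransPG (v i) (v (lift i j)))).
Proof.
apply: eq_bigr => i _; congr (_ * _).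
set f := fun x => _.
have df : differentiable f p.
  exact: (smooth_differentiable _ inv_form_smooth).
pose c s := p + s *: v i.
have c0 : c 0 = p by rewrite /c scale0r addr0.
have dl x : is_derive (0 : R) (1 : R) (fun s => s *: x : PGq) x.
  apply: (is_derive_from_coord (C := PG_coordinates)) => k.
  under eq_fun do rewrite coordZ.
  have := is_derive_mul (is_derive_id (0 : R) 1) (is_derive_cst (coord_fun k x) _ _).
  by rewrite /= mul0r add0r mul1r.
have dc : is_derive (0 : R) (1 : R) c (v i).
  by have := is_deriveD (is_derive_cst p _ _) (dl (v i)); rewrite add0r.
have H1 := is_derive_along df c0 dc.
have H2 : is_derive (0 : R) (1 : R)
    (fun s => W (fun j => ltransPG (c s) (v (lift i j))))
    (0 + \sum_j W (upd (fun j => ltransPG (c 0) (v (lift i j))) j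
       (ltransPG (v i) (v (lift i j))))).
  apply: (@is_derive_multilinear _ _ PG_coordinates _ (fun=> W) (fun=> 0)) =>
    [//|u|k j]; first exact: is_derive_cst.
  have lin t x y : ltransPG (t *: x + y) (v (lift i j)) =
      t *: ltransPG x (v (lift i j)) + ltransPG y (v (lift i j)).
    exact: ltransPG_linearl.
  exact: (@is_derive_linear_coord _ _ PG_coordinates
    (fun x => ltransPG x (v (lift i j))) k c (v i) lin dc).
rewrite -(@derive_val _ _ _ _ _ _ _ H1) (@derive_val _ _ _ _ _ _ _ H2).
by rewrite add0r c0.
Qed.

Lemma inv_form_smooth_extension (w : form PGq r) :
  form_eq (PG G (q := q)) w (inv_form W) ->
  smooth_extension (PG G (q := q)) w (inv_form W).
Proof.
move=> wW; exists [set: PGq]; split => //; first exact: openT.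
  exact: inv_form_smooth.
exact: form_eq_sym.
Qed.

(** W is constant, so only the left translations of the arguments contribute to
    the Leibniz rule; differentiating v |-> p^T v along another tangent vector
    gives A_i^T A_k, which is - A_i A_k by skewness. *)
Lemma ext_diff_inv_form (w : form PGq r) :
  form_eq (PG G (q := q)) w (inv_form W) ->
  form_eq (PG G (q := q)) (ext_diff (PG G (q := q)) w) (inv_form (lie_diff W)).
Proof.
move=> wW p v Gp Tv.
rewrite (ext_diffE PG_coordinates PG_fields (inv_form_smooth_extension wW)) //.
rewrite ext_diff_open_inv_form; apply: eq_bigr => i _; congr (_ * _).
apply: eq_bigr => j _; congr (W (upd _ _ _)).
apply: pr_inj => k; rewrite prN pr_mulPG pr_ltransPG.
rewrite -{1}(mulPGK (v i) Gp) -{1}(mulPGK (v (lift i j)) Gp) !pr_mulPG.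
rewrite trmx_mul mulmxA -[_ *m pr k p]mulmxA (Gp k).1 mulmx1.
by rewrite (tangent_PG_skew k Gp (Tv i)) mulNmx.
Qed.

End InvariantForms.

(** * The canonical connection and its curvature *)

Section LinearMaps.
Context {R : realType} {V W : normedModType R}.

Lemma diff_linear (C : coordinates V) (f : V -> W) (x v : V) :
  (forall c y z, f (c *: y + z) = c *: f y + f z) -> 'd f x v = f v.
Proof.
move=> flin.
have f0 : f 0 = 0.
  by have := flin (-1) 0 0; rewrite scaler0 addr0 scaleN1r addNr.
have df : differentiable f x.
  have -> : f = fun y => \sum_k coord_fun k y *: f (@coord_vec R V C k).
    apply: funext => y; rewrite -{1}(coord_expand C y).
    rewrite (big_morph f (id1 := 0) (op1 := +%R)) //.
      by apply: eq_bigr => k _; rewrite -[_ *: _]addr0 flin f0 addr0.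
    by move=> a b; rewrite -[a in LHS]scale1r flin scale1r.
  elim: (index_enum _) => [|k l IH].
    by under eq_fun do rewrite big_nil; exact: differentiable_cst.
  under eq_fun do rewrite big_cons.
  by apply: differentiableD => //; apply: differentiableZl; exact: coord_differentiable.
by rewrite -deriveE // (@derive_val _ _ _ _ _ _ _ (is_derive_linear x v flin)).
Qed.

End LinearMaps.

Section Connection.
Context {R : realType} {n q : nat}.
Local Notation G := (@SO R n).
Local Notation PGq := (ambPG R n q).
Local Notation DPGq := (ambDPG R n q).

Lemma diff_pr i (p v : PGq) : 'd (pr i) p v = pr i v.
Proof. by apply: (diff_linear PG_coordinates) => c y z; exact: pr_linear. Qed.

Lemma diff_toPG (x v : DPGq) : 'd (@toPG R n q) x v = v.2.
Proof. exact: (diff_linear DPG_coordinates). Qed.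

Lemma SO_invmx (g : 'M[R]_n) : G g -> invmx g = g^T.
Proof.
move=> Gg; have gu : g \in unitmx by rewrite unitmxE Gg.2 unitr1.
by rewrite -[LHS]mul1mx -Gg.1 mulmxK.
Qed.

Lemma thetaE i a b (p : PGq) v : PG G p ->
  theta i a b p v = pr i (ltransPG p (v ord0)) a b.
Proof.
move=> Gp; rewrite /theta mxE /pullback /maurer_cartan mxE diff_pr pr_ltransPG.
by rewrite SO_invmx //; exact: Gp.
Qed.

(** The connection, extended to all points by replacing the inverse of a group
    element with its transpose, which is polynomial. *)
Definition conn (x v : DPGq) : 'M[R]_n :=
  \sum_i x.1 0 i *: pr i (ltransPG x.2 v.2).

(** The curvature d theta + theta /\ theta with d theta expanded: the terms come
    from dt_i /\ theta_i, from t_i d theta_i and from theta /\ theta. *)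
Definition curv (x v w : DPGq) : 'M[R]_n :=
  \sum_i (v.1 0 i *: pr i (ltransPG x.2 w.2) - w.1 0 i *: pr i (ltransPG x.2 v.2)) -
  \sum_i x.1 0 i *: (pr i (ltransPG x.2 v.2) *m pr i (ltransPG x.2 w.2) -
                     pr i (ltransPG x.2 w.2) *m pr i (ltransPG x.2 v.2)) +
  (conn x v *m conn x w - conn x w *m conn x v).

Lemma connE x v a b :
  conn x v a b = \sum_i x.1 0 i * pr i (ltransPG x.2 v.2) a b.
Proof. by rewrite /conn summxE; apply: eq_bigr => i _; rewrite mxE. Qed.

Lemma connectionE a b x v : DPG G x ->
  connection q a b x v = conn x (v ord0) a b.
Proof.
move=> Gx; rewrite connE /connection mxE; apply: eq_bigr => i _.
by rewrite /pullback thetaE ?diff_toPG //; exact: Gx.2.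
Qed.

Definition conn_form a b : form DPGq 1 := fun x v => conn x (v ord0) a b.

Lemma is_derive_conn a b (x u v : DPGq) :
  is_derive x u (fun x => conn x v a b)
    (\sum_i (x.1 0 i * pr i (ltransPG u.2 v.2) a b +
             u.1 0 i * pr i (ltransPG x.2 v.2) a b)).
Proof.
under eq_fun do rewrite connE.
apply: is_derive_bigsum => i; apply: is_derive_mul.
  by apply: (is_derive_linear (f := fun x : DPGq => x.1 0 i)) => c y z; rewrite /= !mxE.
apply: (is_derive_linear (f := fun x : DPGq => pr i (ltransPG x.2 v.2) a b)) => c y z.
by rewrite /= ltransPG_linearl pr_linear !mxE.
Qed.

Lemma conn_form_smooth a b : smooth_form_on_open [set: DPGq] (conn_form a b).
Proof.
split=> [x _|v]; first split.
- move=> v i c y z; rewrite /conn_form !connE ord1 /= mulr_sumr -big_split.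
  apply: eq_bigr => j _ /=.
  rewrite ltransPG_linear pr_linear.
  by move: (pr j _) (pr j _) => M N; rewrite !mxE; ring.
- by move=> v i j; rewrite !ord1 eqxx.
rewrite /conn_form; under eq_fun do rewrite connE.
apply: smooth_bigsum => i; apply: smooth_mul.
  by apply: (smooth_linear DPG_coordinates) => c y z; rewrite /= !mxE.
apply: (smooth_linear DPG_coordinates) => c y z.
by rewrite /= ltransPG_linearl pr_linear !mxE.
Qed.

Lemma ext_diff_connection a b x v :
  DPG G x -> (forall i, tangent (DPG G (q := q)) x (v i)) ->
  ext_diff (DPG G (q := q)) (connection q a b) x v =
  \sum_i ((v 0).1 0 i * pr i (ltransPG x.2 (v 1).2) a b -
          (v 1).1 0 i * pr i (ltransPG x.2 (v 0).2) a b) -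
  \sum_i x.1 0 i * (pr i (ltransPG x.2 (v 0).2) *m pr i (ltransPG x.2 (v 1).2) -
    pr i (ltransPG x.2 (v 1).2) *m pr i (ltransPG x.2 (v 0).2)) a b.
Proof.
move=> Gx Tv.
have ext : smooth_extension (DPG G (q := q)) (connection q a b) (conn_form a b).
  exists [set: DPGq]; split => //; first exact: openT.
    exact: conn_form_smooth.
  by move=> y u Gy Tu; rewrite connectionE.
rewrite (ext_diffE DPG_coordinates DPG_fields ext) //.
rewrite /ext_diff_open big_ord_recl big_ord1 expr0 mul1r expr1 mulN1r.
rewrite /conn_form.
have -> : lift (lift ord0 ord0 : 'I_2) ord0 = 0 by apply: val_inj.
have -> : lift (ord0 : 'I_2) ord0 = 1 by apply: val_inj.
rewrite !(@derive_val _ _ _ _ _ _ _ (is_derive_conn _ _ _ _ _)).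
have ll i k l : pr i (ltransPG (v k).2 (v l).2) =
    - (pr i (ltransPG x.2 (v k).2) *m pr i (ltransPG x.2 (v l).2)).
  have [Tk _] := tangent_DPG_inv Gx (Tv k); have Gp : PG G x.2 := Gx.2.
  rewrite pr_ltransPG -{1}(mulPGK (v k).2 Gp) -{1}(mulPGK (v l).2 Gp) !pr_mulPG.
  rewrite trmx_mul mulmxA -[_ *m pr i x.2]mulmxA (Gp i).1 mulmx1.
  by rewrite (tangent_PG_skew i Gp Tk) mulNmx.
rewrite -!sumrB; apply: eq_bigr => i _; rewrite !ll.
set A := _ *m _; set B := _ *m pr i (ltransPG x.2 (v 0).2).
move: A B (pr i _) (pr i _) => A B M N; rewrite !mxE; ring.
Qed.

End Connection.

(** * Signed sums over small symmetric groups *)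

Section PermutationSums.
Context {R : realType}.

Lemma sum_perm_ord0 n (F : 'S_n.+1 -> R) :
  \sum_s F s = \sum_(i < n.+1) \sum_(s : 'S_n) F (lift_perm ord0 i s).
Proof.
rewrite pair_bigA /=.
pose f (u : 'I_n.+1 * 'S_n) := lift_perm ord0 u.1 u.2.
have finj : injective f.
  move=> [i s] [j t] /= E; have ij : i = j.
    by have := congr1 (fun p : 'S_n.+1 => p ord0) E; rewrite /f !lift_perm_id.
  congr (_, _) => //; apply/permP => k.
  have := congr1 (fun p : 'S_n.+1 => p (lift ord0 k)) E.
  by rewrite /f !lift_perm_lift /= ij => /lift_inj.
rewrite (reindex f) //; apply: onW_bij; apply: inj_card_bij finj _.
by rewrite card_prod !card_Sn card_ord factS.
Qed.

Lemma sum_sign_perm_ord0 n (F : 'S_n.+1 -> R) :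
  \sum_(s : 'S_n.+1) (-1) ^+ s * F s =
  \sum_(i < n.+1) (-1) ^+ i *
    \sum_(s : 'S_n) (-1) ^+ s * F (lift_perm ord0 i s).
Proof.
rewrite sum_perm_ord0; apply: eq_bigr => i _; rewrite mulr_sumr.
apply: eq_bigr => s _.
by rewrite odd_lift_perm signr_addb /= (signr_odd _ i) mulrA.
Qed.

Lemma sum_sign_perm1 (F : 'S_1 -> R) : \sum_(s : 'S_1) (-1) ^+ s * F s = F 1%g.
Proof.
have S1 (s : 'S_1) : s = 1%g by apply/permP => k; rewrite !ord1.
rewrite (bigD1 1%g) //= big1 ?addr0 ?odd_perm1 ?mul1r // => s.
by rewrite (S1 s) eqxx.
Qed.

(** The summands below depend on the values of the permutation as natural
    numbers, so that the values of [lift] compute. *)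
Lemma sum_sign_perm2 (H : nat -> nat -> R) :
  \sum_(s : 'S_2) (-1) ^+ s * H (s 0) (s 1) = H 0 1 - H 1 0.
Proof.
have o1 : 1 = lift ord0 0 :> 'I_2 by apply: val_inj.
rewrite sum_sign_perm_ord0 !big_ord_recl big_ord0.
rewrite !sum_sign_perm1 o1 !lift_perm_id !lift_perm_lift !perm1 /=.
by rewrite /bump /=; ring.
Qed.

Lemma sum_sign_perm3 (H : nat -> nat -> nat -> R) :
  \sum_(s : 'S_3) (-1) ^+ s * H (s 0) (s 1) (s 2%:R) =
  H 0 1 2 - H 0 2 1 - H 1 0 2 + H 1 2 0 + H 2 0 1 - H 2 1 0.
Proof.
have o1 : 1 = lift ord0 0 :> 'I_3 by apply: val_inj.
have o2 : 2%:R = lift ord0 1 :> 'I_3 by apply: val_inj.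
rewrite sum_sign_perm_ord0.
under eq_bigr => i _.
  under eq_bigr => s _ do rewrite o2 o1 lift_perm_id !lift_perm_lift /=.
  rewrite (sum_sign_perm2 (fun a b => H i (bump i a) (bump i b))); over.
by rewrite !big_ord_recl big_ord0 /= /bump /=; ring.
Qed.

Lemma sum_sign_perm4 (H : nat -> nat -> nat -> nat -> R) :
  \sum_(s : 'S_4) (-1) ^+ s * H (s 0) (s 1) (s 2%:R) (s 3%:R) =
  H 0 1 2 3 - H 0 1 3 2 - H 0 2 1 3 + H 0 2 3 1 + H 0 3 1 2 - H 0 3 2 1
  - H 1 0 2 3 + H 1 0 3 2 + H 1 2 0 3 - H 1 2 3 0 - H 1 3 0 2 + H 1 3 2 0
  + H 2 0 1 3 - H 2 0 3 1 - H 2 1 0 3 + H 2 1 3 0 + H 2 3 0 1 - H 2 3 1 0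
  - H 3 0 1 2 + H 3 0 2 1 + H 3 1 0 2 - H 3 1 2 0 - H 3 2 0 1 + H 3 2 1 0.
Proof.
have o1 : 1 = lift ord0 0 :> 'I_4 by apply: val_inj.
have o2 : 2%:R = lift ord0 1 :> 'I_4 by apply: val_inj.
have o3 : 3%:R = lift ord0 2%:R :> 'I_4 by apply: val_inj.
rewrite sum_sign_perm_ord0.
under eq_bigr => i _.
  under eq_bigr => s _ do rewrite o3 o2 o1 lift_perm_id !lift_perm_lift /=.
  rewrite (sum_sign_perm3 (fun a b c => H i (bump i a) (bump i b) (bump i c))); over.
by rewrite !big_ord_recl big_ord0 /= /bump /=; ring.
Qed.

End PermutationSums.

(** * The Pfaffian on 4 x 4 matrices *)

Section PfaffianForm.
Context {R : realType}.
Implicit Types (A B C X : 'M[R]_4).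

(** The bilinear form Pf without its factor 1 / (32 pi^2). *)
Definition pfaff A B : R :=
  \sum_(tau : 'S_4) (-1) ^+ tau *
    (A (tau 0) (tau 1) * B (tau 2%:R) (tau 3%:R)).

Local Notation "A '_[' i , j ]" := (A (inord i : 'I_4) (inord j : 'I_4))
  (at level 2, i at level 99, j at level 99).

Lemma pfaffE A B : pfaff A B =
  (A _[0, 1] - A _[1, 0]) * (B _[2, 3] - B _[3, 2]) -
  (A _[0, 2] - A _[2, 0]) * (B _[1, 3] - B _[3, 1]) +
  (A _[0, 3] - A _[3, 0]) * (B _[1, 2] - B _[2, 1]) +
  (A _[1, 2] - A _[2, 1]) * (B _[0, 3] - B _[3, 0]) -
  (A _[1, 3] - A _[3, 1]) * (B _[0, 2] - B _[2, 0]) +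
  (A _[2, 3] - A _[3, 2]) * (B _[0, 1] - B _[1, 0]).
Proof.
pose H a b c d : R := A _[a, b] * B _[c, d].
transitivity (\sum_(tau : 'S_4) (-1) ^+ tau *
    H (tau 0) (tau 1) (tau 2%:R) (tau 3%:R)).
  by apply: eq_bigr => tau _; rewrite /H !inord_val.
rewrite sum_sign_perm4 /H; ring.
Qed.

Lemma pfaffC A B : pfaff A B = pfaff B A.
Proof. by rewrite !pfaffE; ring. Qed.

Lemma pfaff_linear B k A C : pfaff (k *: A + C) B = k * pfaff A B + pfaff C B.
Proof.
have E i j : (k *: A + C) i j = k * A i j + C i j by rewrite !mxE.
rewrite /pfaff mulr_sumr -big_split; apply: eq_bigr => tau _.
rewrite E; move: (_ ^+ _) (A _ _) (B _ _) (C _ _) => s a b c /=; ring.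
Qed.

Lemma pfaffDl A B C : pfaff (A + B) C = pfaff A C + pfaff B C.
Proof. by have := pfaff_linear C 1 A B; rewrite scale1r mul1r. Qed.

Lemma pfaff0l C : pfaff 0 C = 0.
Proof. by apply: (addrI (pfaff 0 C)); rewrite -pfaffDl !addr0. Qed.

Lemma pfaffZl k A C : pfaff (k *: A) C = k * pfaff A C.
Proof. by rewrite -[k *: A]addr0 pfaff_linear pfaff0l addr0. Qed.

Lemma pfaffNl A C : pfaff (- A) C = - pfaff A C.
Proof. by rewrite -scaleN1r pfaffZl mulN1r. Qed.

Lemma pfaffBl A B C : pfaff (A - B) C = pfaff A C - pfaff B C.
Proof. by rewrite pfaffDl pfaffNl. Qed.

Lemma pfaffDr A B C : pfaff C (A + B) = pfaff C A + pfaff C B.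
Proof. by rewrite !(pfaffC C) pfaffDl. Qed.

Lemma pfaff0r C : pfaff C 0 = 0.
Proof. by rewrite pfaffC pfaff0l. Qed.

Lemma pfaffZr k A C : pfaff C (k *: A) = k * pfaff C A.
Proof. by rewrite !(pfaffC C) pfaffZl. Qed.

Lemma pfaffNr A C : pfaff C (- A) = - pfaff C A.
Proof. by rewrite !(pfaffC C) pfaffNl. Qed.

Lemma pfaffBr A B C : pfaff C (A - B) = pfaff C A - pfaff C B.
Proof. by rewrite !(pfaffC C) pfaffBl. Qed.

Lemma pfaff_tr A B : pfaff A B^T = - pfaff A B.
Proof. by rewrite !pfaffE ![B^T _ _]mxE; ring. Qed.

Lemma mulmx4E A B i j : (A *m B) i j =
  A i (inord 0) * B (inord 0) j + A i (inord 1) * B (inord 1) j +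
  A i (inord 2) * B (inord 2) j + A i (inord 3) * B (inord 3) j.
Proof.
rewrite mxE !big_ord_recl big_ord0 addr0 !addrA.
by do !congr (_ + _); congr (A _ _ * B _ _); apply: val_inj; rewrite /= inordK.
Qed.

(** The Pfaffian is invariant under conjugation by rotations; this is the
    infinitesimal form of that invariance. *)
Lemma pfaff_invariant X A B : skew X ->
  pfaff (X *m A - A *m X) B + pfaff A (X *m B - B *m X) = 0.
Proof.
move=> sX.
have Xji i j : X i j = - X j i.
  by have := congr1 (fun M : 'M[R]_4 => M j i) sX; rewrite !mxE.
have Xii i : X i i = 0.
  by apply/eqP; have /eqP := Xji i i; rewrite -addr_eq0 -mulr2n mulrn_eq0.
rewrite !pfaffE.
have E M N i j : (M *m N - N *m M) i j = (M *m N) i j - (N *m M) i j.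
  by move=> *; rewrite mxE [X in _ + X]mxE.
rewrite !E !mulmx4E !Xii.
rewrite !(Xji (inord 1) (inord 0)) !(Xji (inord 2) (inord 0)) !(Xji (inord 3) (inord 0)).
rewrite !(Xji (inord 2) (inord 1)) !(Xji (inord 3) (inord 1)) !(Xji (inord 3) (inord 2)).
ring.
Qed.

(** On skew matrices this is half of pfaff A [B, C], hence totally antisymmetric
    by invariance of the Pfaffian. *)
Definition pfaff3 A B C : R := pfaff A (B *m C).

Lemma pfaff3_swap A B C : skew B -> skew C -> pfaff3 A C B = - pfaff3 A B C.
Proof.
move=> sB sC; rewrite /pfaff3 -pfaff_tr trmx_mul sB sC.
by rewrite mulNmx mulmxN opprK.
Qed.

(** The invariance identity for the infinitesimal rotation B. *)
Lemma pfaff3_rot A B C : skew A -> skew B -> skew C ->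
  pfaff3 C A B = pfaff3 A B C.
Proof.
move=> sA sB sC; have := pfaff_invariant A C sB.
rewrite pfaffBl pfaffBr !(pfaffC _ C) -!/(pfaff3 _ _ _).
rewrite (pfaff3_swap C sA sB) (pfaff3_swap A sB sC) !opprK => H; lra.
Qed.

End PfaffianForm.

(** * Cochains of the Lie algebra *)

Section InvariantCochains.
Context {R : realType}.

Section Expansions.
Context {n q : nat}.
Local Notation PGq := (ambPG R n q).
Implicit Types (A : PGq).
Local Notation "A ** B" := (mulPG A B) (at level 40).

Lemma lie_diff2 (f : PGq -> PGq -> R) (A : 'I_3 -> PGq) :
  lie_diff (fun u : 'I_2 -> PGq => f (u 0) (u 1)) A =
  let a := A 0 in let b := A 1 in let c := A 2%:R in
  (f (- (a ** b)) c + f b (- (a ** c))) - (f (- (b ** a)) c + f a (- (b ** c)))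
  + (f (- (c ** a)) b + f a (- (c ** b))).
Proof.
have AE k : A k = A (inord k) by rewrite inord_val.
rewrite /lie_diff !big_ord_recl !big_ord0 !updE /=.
rewrite !(AE 0) !(AE 1) !(AE 2%:R) !(AE (lift _ _)) ?(AE ord0) /= /bump /=.
ring.
Qed.

Lemma lie_diff3 (f : PGq -> PGq -> PGq -> R) (A : 'I_4 -> PGq) :
  lie_diff (fun u : 'I_3 -> PGq => f (u 0) (u 1) (u 2%:R)) A =
  let a := A 0 in let b := A 1 in let c := A 2%:R in let d := A 3%:R in
  (f (- (a ** b)) c d + f b (- (a ** c)) d + f b c (- (a ** d)))
  - (f (- (b ** a)) c d + f a (- (b ** c)) d + f a c (- (b ** d)))
  + (f (- (c ** a)) b d + f a (- (c ** b)) d + f a b (- (c ** d)))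
  - (f (- (d ** a)) b c + f a (- (d ** b)) c + f a b (- (d ** c))).
Proof.
have AE k : A k = A (inord k) by rewrite inord_val.
rewrite /lie_diff !big_ord_recl !big_ord0 !updE /=.
rewrite !(AE 0) !(AE 1) !(AE 2%:R) !(AE 3%:R) !(AE (lift _ _)) ?(AE ord0) /= /bump /=.
ring.
Qed.

End Expansions.

Section Cochains.
Context {q : nat}.
Local Notation PGq := (ambPG R 4 q).

Definition skew_part (M : 'M[R]_4) : 'M[R]_4 := 2^-1 *: (M - M^T).

Lemma skew_part_skew M : skew (skew_part M).
Proof. by rewrite /skew /skew_part linearZ linearB /= trmxK -scalerN opprB. Qed.

Lemma skew_part_id M : skew M -> skew_part M = M.
Proof.
move=> sM; rewrite /skew_part sM opprK -[M + M]mulr2n -[M *+ 2]scaler_nat.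
by rewrite scalerA mulVf ?scale1r.
Qed.

Lemma skew_part_linear k M N :
  skew_part (k *: M + N) = k *: skew_part M + skew_part N.
Proof.
by apply/matrixP => i j; rewrite !mxE; ring.
Qed.

Definition pfaff_cochain (L M : PGq -> 'M[R]_4) (u : 'I_2 -> PGq) : R :=
  pfaff (L (u 0)) (M (u 1)) - pfaff (L (u 1)) (M (u 0)).

(** On skew matrices the trilinear form is already alternating; taking skew
    parts makes it so on all matrices. *)
Definition pfaff3_cochain (L : PGq -> 'M[R]_4) (u : 'I_3 -> PGq) : R :=
  pfaff3 (skew_part (L (u 0))) (skew_part (L (u 1))) (skew_part (L (u 2%:R))).

Definition linear_map (L : PGq -> 'M[R]_4) : Prop :=
  forall k x y, L (k *: x + y) = k *: L x + L y.

Lemma ord2P (i : 'I_2) : i = 0 \/ i = 1.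
Proof. by case: i => [[|[|//]] h]; [left|right]; apply: val_inj. Qed.

Lemma ord3P (i : 'I_3) : [\/ i = 0, i = 1 | i = 2%:R].
Proof.
by case: i => [[|[|[|//]]] h]; [apply: Or31|apply: Or32|apply: Or33]; apply: val_inj.
Qed.

Lemma pfaff_cochain_multilinear L M : linear_map L -> linear_map M ->
  multilinear_form (pfaff_cochain L M).
Proof.
move=> Ll Ml v i k x y; rewrite /pfaff_cochain.
by have [->|->] := ord2P i;
  rewrite /= ?Ll ?Ml !(pfaffDl, pfaffZl, pfaffDr, pfaffZr); ring.
Qed.

Lemma pfaff_cochain_alternating L M : alternating_form (pfaff_cochain L M).
Proof.
move=> v i j; rewrite /pfaff_cochain.
by have [->|->] := ord2P i; have [->|->] := ord2P j => // _ ->; rewrite subrr.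
Qed.

Lemma pfaff3_linear1 k A A' B C :
  pfaff3 (k *: A + A') B C = k * pfaff3 A B C + pfaff3 A' B C :> R.
Proof. exact: pfaff_linear. Qed.

Lemma pfaff3_linear2 k A B B' C :
  pfaff3 A (k *: B + B') C = k * pfaff3 A B C + pfaff3 A B' C :> R.
Proof. by rewrite /pfaff3 mulmxDl -scalemxAl pfaffDr pfaffZr. Qed.

Lemma pfaff3_linear3 k A B C C' :
  pfaff3 A B (k *: C + C') = k * pfaff3 A B C + pfaff3 A B C' :> R.
Proof. by rewrite /pfaff3 mulmxDr -scalemxAr pfaffDr pfaffZr. Qed.

Lemma pfaff3_cochain_multilinear L : linear_map L ->
  multilinear_form (pfaff3_cochain L).
Proof.
move=> Ll v i k x y; rewrite /pfaff3_cochain.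
have [->|->|->] := ord3P i; rewrite /= Ll skew_part_linear.
- exact: pfaff3_linear1.
- exact: pfaff3_linear2.
- exact: pfaff3_linear3.
Qed.

Lemma pfaff3_xx (A B : 'M[R]_4) : skew A -> skew B -> pfaff3 B A A = 0.
Proof. by move=> sA sB; have := pfaff3_swap B sA sA; lra. Qed.

Lemma pfaff3_cochain_alternating L : alternating_form (pfaff3_cochain L).
Proof.
have sk M := skew_part_skew M.
move=> v i j; rewrite /pfaff3_cochain.
have [->|->|->] := ord3P i; have [->|->|->] := ord3P j => // _ ->.
- by rewrite -pfaff3_rot // pfaff3_xx.
- by rewrite pfaff3_rot // pfaff3_xx.
- by rewrite -pfaff3_rot // pfaff3_xx.
- by rewrite pfaff3_xx.
- by rewrite pfaff3_rot // pfaff3_xx.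
- by rewrite pfaff3_xx.
Qed.

End Cochains.

End InvariantCochains.

Section CochainIdentities.
Context {R : realType}.
Implicit Types (A B C D X : 'M[R]_4).

Definition commutator A B : 'M[R]_4 := A *m B - B *m A.

Lemma commutator_skew A B : skew A -> skew B -> skew (commutator A B).
Proof.
move=> sA sB; rewrite /skew /commutator linearB /= !trmx_mul sA sB.
by rewrite !mulNmx !mulmxN !opprK opprB.
Qed.

Lemma commutatorC A B : commutator A B = - commutator B A.
Proof. by rewrite /commutator opprB. Qed.

Lemma skewB A B : skew A -> skew B -> skew (A - B).
Proof. by move=> sA sB; rewrite /skew linearB /= sA sB opprD. Qed.

Lemma skewD A B : skew A -> skew B -> skew (A + B).
Proof. by move=> sA sB; rewrite /skew linearD /= sA sB opprD. Qed.

Lemma pfaff3_invariant X A B C : skew X ->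
  pfaff3 (commutator X A) B C + pfaff3 A (commutator X B) C +
  pfaff3 A B (commutator X C) = 0.
Proof.
move=> sX; rewrite -(pfaff_invariant A (B *m C) sX) -addrA; congr (_ + _).
rewrite /pfaff3 -pfaffDr /commutator mulmxBl mulmxBr !mulmxA.
by rewrite addrA subrK.
Qed.

Lemma pfaff3_move2 A B C : skew A -> skew B -> skew C ->
  pfaff3 B A C = - pfaff3 A B C.
Proof. by move=> sA sB sC; rewrite pfaff3_rot // pfaff3_swap. Qed.

Lemma pfaff3_move3 A B C : skew A -> skew B -> skew C ->
  pfaff3 B C A = pfaff3 A B C.
Proof. by move=> sA sB sC; rewrite -pfaff3_rot. Qed.

Lemma pfaff3Zl k A B C : pfaff3 (k *: A) B C = k * pfaff3 A B C.
Proof. exact: pfaffZl. Qed.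

Lemma pfaff3Zm k A B C : pfaff3 A (k *: B) C = k * pfaff3 A B C.
Proof. by rewrite /pfaff3 -scalemxAl pfaffZr. Qed.

Lemma pfaff3Zr k A B C : pfaff3 A B (k *: C) = k * pfaff3 A B C.
Proof. by rewrite /pfaff3 -scalemxAr pfaffZr. Qed.

Lemma pfaff3Bl A A' B C : pfaff3 (A - A') B C = pfaff3 A B C - pfaff3 A' B C.
Proof. exact: pfaffBl. Qed.

Lemma pfaff3Bm A B B' C : pfaff3 A (B - B') C = pfaff3 A B C - pfaff3 A B' C.
Proof. by rewrite /pfaff3 mulmxBl pfaffBr. Qed.

Lemma pfaff3Br A B C C' : pfaff3 A B (C - C') = pfaff3 A B C - pfaff3 A B C'.
Proof. by rewrite /pfaff3 mulmxBr pfaffBr. Qed.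

Lemma pfaff_mull A B C : pfaff (A *m B) C = pfaff3 C A B.
Proof. exact: pfaffC. Qed.

Lemma pfaff_commutator A B C : skew B -> skew C ->
  pfaff A (commutator B C) = 2 * pfaff3 A B C.
Proof.
move=> sB sC; rewrite /commutator pfaffBr -!/(pfaff3 _ _ _).
by rewrite (pfaff3_swap A sB sC); ring.
Qed.

Lemma pfaff3_alternating_sum A B C : skew A -> skew B -> skew C ->
  pfaff A (commutator B C) - pfaff B (commutator A C) + pfaff C (commutator A B) =
  6 * pfaff3 A B C.
Proof.
move=> sA sB sC; rewrite !pfaff_commutator //.
by rewrite (pfaff3_move2 sA sB sC) (pfaff3_rot sA sB sC); ring.
Qed.

Lemma skew_part_mul A B : skew A -> skew B ->
  skew_part (- (A *m B)) = - 2^-1 *: commutator A B.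
Proof.
move=> sA sB; rewrite /skew_part linearN /= trmx_mul sA sB mulNmx mulmxN !opprK.
by rewrite scaleNr -scalerN /commutator opprB addrC.
Qed.

(** The four summands of the differential vanish separately: the three terms
    of each are those of the invariance of the trilinear form under one of the
    arguments. *)
Lemma lie_diff_pfaff3 (q : nat) (i : 'I_q.+1) (A : 'I_4 -> ambPG R 4 q) :
  (forall i k, skew (pr i (A k))) -> lie_diff (pfaff3_cochain (pr i)) A = 0.
Proof.
move=> sA.
rewrite (lie_diff3 (fun a b c => pfaff3 (skew_part (pr i a)) (skew_part (pr i b))
  (skew_part (pr i c)))) /=.
have sA0 k := sA k 0; have sA1 k := sA k 1.
have sA2 k := sA k 2%:R; have sA3 k := sA k 3%:R.
move: (A 0) (A 1) (A 2%:R) (A 3%:R) sA0 sA1 sA2 sA3 => x y z t Sx Sy Sz St.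
rewrite !prN !pr_mulPG !skew_part_mul // !(skew_part_id (_ : skew (pr i _))) //.
move: (Sx i) (Sy i) (Sz i) (St i).
move: (pr i x) (pr i y) (pr i z) (pr i t) => a b c d Sa Sb Sc Sd.
rewrite !(pfaff3Zl, pfaff3Zm, pfaff3Zr).
have := pfaff3_invariant b c d Sa; have := pfaff3_invariant a c d Sb.
have := pfaff3_invariant a b d Sc; have := pfaff3_invariant a b c Sd.
(* The values of the trilinear form are made opaque for linear arithmetic. *)
have [N NE] : exists N, forall A B C, pfaff3 A B C = N A B C :> R by eexists.
by rewrite !NE; clear; lra.
Qed.

(** With s and d the sum and the difference of the two components of a vector,
    the difference of their commutators is ([s, d'] + [d, s']) / 2. *)
Lemma skew_part_sub_mul (q : nat) (i j : 'I_q.+1) (x y : ambPG R 4 q) :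
  (forall i, skew (pr i x)) -> (forall i, skew (pr i y)) ->
  skew_part (pr i (- mulPG x y) - pr j (- mulPG x y)) =
  - 4^-1 *: (commutator (pr i x + pr j x) (pr i y - pr j y) -
             commutator (pr i y + pr j y) (pr i x - pr j x)).
Proof.
move=> sx sy.
rewrite [skew_part _](_ : _ = skew_part (pr i (- mulPG x y)) -
  skew_part (pr j (- mulPG x y))); last first.
  by apply/matrixP => k l; rewrite /skew_part !mxE; ring.
rewrite !prN !pr_mulPG !skew_part_mul // /commutator.
move: (pr i x) (pr i y) (pr j x) (pr j y) => a b a' b'.
rewrite !(mulmxBl, mulmxBr, mulmxDl, mulmxDr).
move: (a *m b) (b *m a) (a' *m b') (b' *m a') (a *m b') (b' *m a) (a' *m b) (b *m a').
move=> M1 M2 M3 M4 M5 M6 M7 M8.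
by apply/matrixP => k l; rewrite !mxE; field.
Qed.

(** Collecting the terms with a given s_k gives the invariance of the trilinear
    form under s_k, evaluated on the other three d's. *)
Lemma pfaff3_symmetric_cancel (s0 s1 s2 s3 d0 d1 d2 d3 : 'M[R]_4) :
  [/\ skew s0, skew s1, skew s2 & skew s3] ->
  [/\ skew d0, skew d1, skew d2 & skew d3] ->
  let h s d s' d' := - 4^-1 *: (commutator s d' - commutator s' d) in
  (pfaff3 (h s0 d0 s1 d1) d2 d3 + pfaff3 d1 (h s0 d0 s2 d2) d3
     + pfaff3 d1 d2 (h s0 d0 s3 d3))
  - (pfaff3 (h s1 d1 s0 d0) d2 d3 + pfaff3 d0 (h s1 d1 s2 d2) d3
     + pfaff3 d0 d2 (h s1 d1 s3 d3))
  + (pfaff3 (h s2 d2 s0 d0) d1 d3 + pfaff3 d0 (h s2 d2 s1 d1) d3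
     + pfaff3 d0 d1 (h s2 d2 s3 d3))
  - (pfaff3 (h s3 d3 s0 d0) d1 d2 + pfaff3 d0 (h s3 d3 s1 d1) d2
     + pfaff3 d0 d1 (h s3 d3 s2 d2)) = 0.
Proof.
move=> [S0 S1 S2 S3] [D0 D1 D2 D3] h.
have hE X Y s d s' d' : pfaff3 (h s d s' d') X Y =
    - 4^-1 * (pfaff3 (commutator s d') X Y - pfaff3 (commutator s' d) X Y).
  by rewrite pfaff3Zl pfaff3Bl.
have sh s d s' d' : skew s -> skew d -> skew s' -> skew d' -> skew (h s d s' d').
  move=> s_ d_ s'_ d'_; rewrite /h /skew linearZ /= -[RHS]scalerN; congr (_ *: _).
  by apply: (skewB (commutator_skew s_ d'_) (commutator_skew s'_ d_)).
have E2 X Y s d s' d' : skew X -> skew Y -> skew s -> skew d -> skew s' ->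
    skew d' -> pfaff3 X (h s d s' d') Y = - pfaff3 (h s d s' d') X Y.
  by move=> *; rewrite pfaff3_move2 //; apply: sh.
have E3 X Y s d s' d' : skew X -> skew Y -> skew s -> skew d -> skew s' ->
    skew d' -> pfaff3 X Y (h s d s' d') = pfaff3 (h s d s' d') X Y.
  by move=> *; rewrite pfaff3_move3 //; apply: sh.
rewrite !(E2 d0) ?(E2 d1) // !(E3 d0) // !(E3 d1) // !hE.
have inv X A B C : skew X -> skew A -> skew B -> skew C ->
    pfaff3 (commutator X A) B C - pfaff3 (commutator X B) A C
    + pfaff3 (commutator X C) A B = 0.
  move=> sX sA sB sC; rewrite -(pfaff3_invariant A B C sX); congr (_ + _ + _).
    by rewrite [RHS]pfaff3_move2 //; apply: commutator_skew.
  by rewrite [RHS]pfaff3_move3 //; apply: commutator_skew.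
have := inv s0 d1 d2 d3; have := inv s1 d0 d2 d3.
have := inv s2 d0 d1 d3; have := inv s3 d0 d1 d2.
have [N NE] : exists N, forall A B C D,
    pfaff3 (commutator A B) C D = N A B C D by eexists.
rewrite !NE => /(_ S3 D0 D1 D2) H3 /(_ S2 D0 D1 D3) H2.
move=> /(_ S1 D0 D2 D3) H1 /(_ S0 D1 D2 D3) H0.
clear -H0 H1 H2 H3; lra.
Qed.

Lemma lie_diff_pfaff3_sub (q : nat) (i j : 'I_q.+1) (A : 'I_4 -> ambPG R 4 q) :
  (forall i k, skew (pr i (A k))) ->
  lie_diff (pfaff3_cochain (fun x => pr i x - pr j x)) A = 0.
Proof.
move=> sA.
have [g gE] : exists g, forall x, skew_part (pr i x - pr j x) = g x :> 'M[R]_4.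
  by eexists.
have -> : pfaff3_cochain (fun x => pr i x - pr j x) =
    fun u => pfaff3 (g (u 0)) (g (u 1)) (g (u 2%:R)).
  by apply: funext => u; rewrite /pfaff3_cochain !gE.
rewrite (lie_diff3 (fun a b c => pfaff3 (g a) (g b) (g c))) /=.
have gM x y sx sy := etrans (esym (gE _)) (@skew_part_sub_mul q i j x y sx sy).
have gA x (sx : forall i, skew (pr i x)) :=
  etrans (esym (gE _)) (skew_part_id (skewB (sx i) (sx j))).
have sA0 k := sA k 0; have sA1 k := sA k 1.
have sA2 k := sA k 2%:R; have sA3 k := sA k 3%:R.
move: (A 0) (A 1) (A 2%:R) (A 3%:R) sA0 sA1 sA2 sA3 => a b c d Sa Sb Sc Sd.
rewrite (gA a Sa) (gA b Sb) (gA c Sc) (gA d Sd).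
rewrite (gM a b Sa Sb) (gM a c Sa Sc) (gM a d Sa Sd).
rewrite (gM b a Sb Sa) (gM b c Sb Sc) (gM b d Sb Sd).
rewrite (gM c a Sc Sa) (gM c b Sc Sb) (gM c d Sc Sd).
rewrite (gM d a Sd Sa) (gM d b Sd Sb) (gM d c Sd Sc).
by apply: pfaff3_symmetric_cancel; split; solve [apply: skewB => //|apply: skewD => //].
Qed.

End CochainIdentities.

(** * Identities of the double complex on Lie algebra cochains *)

Section DoubleComplexIdentities.
Context {R : realType}.

(** A normal form for the trilinear form on three families of skew matrices, in
    which the identities below become linear. *)
Lemma pfaff3_sort (I : Type) (x y z : I -> 'M[R]_4) :
  (forall i, skew (x i)) -> (forall i, skew (y i)) -> (forall i, skew (z i)) ->
  forall i j l,
  (pfaff3 (y i) (x j) (z l) = - pfaff3 (x j) (y i) (z l)) *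
  (pfaff3 (x i) (z j) (y l) = - pfaff3 (x i) (y l) (z j)) *
  (pfaff3 (z i) (y j) (x l) = - pfaff3 (x l) (y j) (z i)) *
  (pfaff3 (y i) (z j) (x l) = pfaff3 (x l) (y i) (z j)) *
  (pfaff3 (z i) (x j) (y l) = pfaff3 (x j) (y l) (z i)).
Proof.
move=> sx sy sz i j l; do !split.
- exact: pfaff3_move2.
- exact: pfaff3_swap.
- by rewrite pfaff3_swap // pfaff3_rot.
- by rewrite pfaff3_move3.
- by rewrite pfaff3_rot.
Qed.

(** The operator d' on left-invariant forms. *)
Definition face_sum (q r : nat) (W : ('I_r -> ambPG R 4 q) -> R)
    (A : 'I_r -> ambPG R 4 q.+1) : R :=
  \sum_(i < q.+2) (-1) ^+ i * W (fun k => face i (A k)).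

Lemma pr_face (q : nat) (i : 'I_q.+2) (j : 'I_q.+1) (x : ambPG R 4 q.+1) :
  pr j (face i x) = pr (lift i j) x.
Proof. by rewrite /pr /face row_rowsub. Qed.

(** Both sides are combinations of values of the trilinear form on mixed
    components of the three vectors. On the left the face maps give the two
    unmixed values, and the differential gives the six mixed ones. *)
Lemma pfaff_component13 (A : 'I_3 -> ambPG R 4 1) :
  (forall i k, skew (pr i (A k))) ->
  2 * face_sum (pfaff3_cochain (pr 0)) A
    - lie_diff (pfaff_cochain (pr 0) (pr 1)) A =
  2 * pfaff3_cochain (fun x => pr 1 x - pr 0 x) A.
Proof.
move=> sA; rewrite /face_sum !big_ord_recl big_ord0 /pfaff3_cochain !pr_face.
have -> : lift ord0 0 = 1 :> 'I_2 by apply: val_inj.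
have -> : lift 1 0 = 0 :> 'I_2 by apply: val_inj.
rewrite (lie_diff2 (fun a b => pfaff (pr 0 a) (pr 1 b) - pfaff (pr 0 b) (pr 1 a))) /=.
have sA0 k := sA k 0; have sA1 k := sA k 1; have sA2 k := sA k 2%:R.
move: (A 0) (A 1) (A 2%:R) sA0 sA1 sA2 => a b c Sa Sb Sc.
rewrite !prN !pr_mulPG.
rewrite !skew_part_id //; try by apply: skewB.
have [x xE] : exists x, forall i, pr i a = x i :> 'M[R]_4 by eexists.
have [y yE] : exists y, forall i, pr i b = y i :> 'M[R]_4 by eexists.
have [z zE] : exists z, forall i, pr i c = z i :> 'M[R]_4 by eexists.
have Sx i : skew (x i) by rewrite -xE.
have Sy i : skew (y i) by rewrite -yE.
have Sz i : skew (z i) by rewrite -zE.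
rewrite !xE !yE !zE !(pfaffNl, pfaffNr, pfaff_mull) -!/(pfaff3 _ _ _).
rewrite !(pfaff3Bl, pfaff3Bm, pfaff3Br) !(pfaff3_sort Sx Sy Sz).
have [N NE] : exists N, forall i j k, pfaff3 (x i) (y j) (z k) = N i j k :> R.
  by eexists.
rewrite !NE; move: (0 : 'I_2) (1 : 'I_2) => o0 o1 /=; ring.
Qed.

Local Notation pr01 := (fun x => pr 1 x - pr 0 x).
Local Notation pr02 := (fun x => pr 2%:R x - pr 0 x).

Lemma face3E :
  ((lift ord0 (lift ord0 ord0) = 2%:R :> 'I_3) *
   (lift 1 0 = 0 :> 'I_3) * (lift 1 1 = 2%:R :> 'I_3) *
   (lift 2%:R 0 = 0 :> 'I_3) * (lift 2%:R 1 = 1 :> 'I_3) *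
   (lift ord0 0 = 1 :> 'I_3) * (lift ord0 1 = 2%:R :> 'I_3))%type.
Proof. by do !split; apply: val_inj. Qed.

Lemma face4E :
  ((lift ord0 (lift ord0 (lift ord0 ord0)) = 3%:R :> 'I_4) *
   (lift ord0 (lift ord0 ord0) = 2%:R :> 'I_4) *
   (lift 1 0 = 0 :> 'I_4) * (lift 1 1 = 2%:R :> 'I_4) * (lift 1 2%:R = 3%:R :> 'I_4) *
   (lift 2%:R 0 = 0 :> 'I_4) * (lift 2%:R 1 = 1 :> 'I_4) *
   (lift 2%:R 2%:R = 3%:R :> 'I_4) *
   (lift 3%:R 0 = 0 :> 'I_4) * (lift 3%:R 1 = 1 :> 'I_4) *
   (lift 3%:R 2%:R = 2%:R :> 'I_4) *
   (lift ord0 0 = 1 :> 'I_4) * (lift ord0 1 = 2%:R :> 'I_4) *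
   (lift ord0 2%:R = 3%:R :> 'I_4))%type.
Proof. by do !split; apply: val_inj. Qed.

Lemma pfaff_component22 (A : 'I_2 -> ambPG R 4 2) :
  face_sum (pfaff_cochain (pr 0) (pr 1)) A = pfaff_cochain pr01 pr02 A.
Proof.
rewrite /face_sum !big_ord_recl big_ord0 /pfaff_cochain !pr_face.
rewrite !face3E.
have C i j : pfaff (pr i (A 1)) (pr j (A 0)) = pfaff (pr j (A 0)) (pr i (A 1)).
  exact: pfaffC.
rewrite !(pfaffBl, pfaffBr) !C /= /bump /=. ring.
Qed.

Lemma pfaff_cocycle23 (A : 'I_3 -> ambPG R 4 2) :
  (forall i k, skew (pr i (A k))) ->
  2 * face_sum (pfaff3_cochain pr01) A + lie_diff (pfaff_cochain pr01 pr02) A = 0.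
Proof.
move=> sA; rewrite /face_sum !big_ord_recl big_ord0 /pfaff3_cochain !pr_face.
rewrite !face3E.
rewrite (lie_diff2 (fun a b => pfaff (pr01 a) (pr02 b) - pfaff (pr01 b) (pr02 a))) /=.
have sA0 k := sA k 0; have sA1 k := sA k 1; have sA2 k := sA k 2%:R.
move: (A 0) (A 1) (A 2%:R) sA0 sA1 sA2 => a b c Sa Sb Sc.
rewrite !prN !pr_mulPG.
rewrite !skew_part_id //; try by apply: skewB.
have [x xE] : exists x, forall i, pr i a = x i :> 'M[R]_4 by eexists.
have [y yE] : exists y, forall i, pr i b = y i :> 'M[R]_4 by eexists.
have [z zE] : exists z, forall i, pr i c = z i :> 'M[R]_4 by eexists.
have Sx i : skew (x i) by rewrite -xE.
have Sy i : skew (y i) by rewrite -yE.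
have Sz i : skew (z i) by rewrite -zE.
rewrite !xE !yE !zE !(pfaffBl, pfaffBr, pfaffNl, pfaffNr, pfaff_mull) -!/(pfaff3 _ _ _).
rewrite !(pfaff3Bl, pfaff3Bm, pfaff3Br) !(pfaff3_sort Sx Sy Sz).
have [N NE] : exists N, forall i j k, pfaff3 (x i) (y j) (z k) = N i j k :> R.
  by eexists.
rewrite !NE; move: (0 : 'I_3) (1 : 'I_3) (2%:R : 'I_3) => o0 o1 o2 /=; ring.
Qed.

Lemma pfaff_cocycle32 (A : 'I_2 -> ambPG R 4 3) :
  face_sum (pfaff_cochain pr01 pr02) A = 0.
Proof.
rewrite /face_sum !big_ord_recl big_ord0 /pfaff_cochain !pr_face.
rewrite !face4E.
have C i j : pfaff (pr i (A 1)) (pr j (A 0)) = pfaff (pr j (A 0)) (pr i (A 1)).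
  exact: pfaffC.
rewrite !(pfaffBl, pfaffBr) !C /= /bump /=; ring.
Qed.


End DoubleComplexIdentities.

(** * Wedge products of matrix-valued forms *)

Section WedgeEvaluation.
Context {R : realType} {V : normedModType R}.

Lemma sum_perm_vec2 (G : V -> V -> R) (v : 'I_2 -> V) :
  \sum_(s : 'S_2) (-1) ^+ s * G (v (s 0)) (v (s 1)) =
  G (v 0) (v 1) - G (v 1) (v 0).
Proof.
have vE k : v k = v (inord k) by rewrite inord_val.
under eq_bigr => s _ do rewrite (vE (s 0)) (vE (s 1)).
rewrite (sum_sign_perm2 (fun a b => G (v (inord a)) (v (inord b)))).
by rewrite (vE 0) (vE 1).
Qed.

Lemma sum_perm_vec3 (G : V -> V -> V -> R) (v : 'I_3 -> V) :
  let a := v 0 in let b := v 1 in let c := v 2%:R in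
  \sum_(s : 'S_3) (-1) ^+ s * G (v (s 0)) (v (s 1)) (v (s 2%:R)) =
  G a b c - G a c b - G b a c + G b c a + G c a b - G c b a.
Proof.
move=> a b c; have vE k : v k = v (inord k) by rewrite inord_val.
under eq_bigr => s _ do rewrite (vE (s 0)) (vE (s 1)) (vE (s 2%:R)).
rewrite (sum_sign_perm3 (fun i j k => G (v (inord i)) (v (inord j)) (v (inord k)))).
by rewrite /a /b /c (vE 0) (vE 1) (vE 2%:R).
Qed.

Lemma sum_perm_vec4 (G : V -> V -> V -> V -> R) (v : 'I_4 -> V) :
  let a := v 0 in let b := v 1 in let c := v 2%:R in let d := v 3%:R in
  \sum_(s : 'S_4) (-1) ^+ s * G (v (s 0)) (v (s 1)) (v (s 2%:R)) (v (s 3%:R)) =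
  G a b c d - G a b d c - G a c b d + G a c d b + G a d b c - G a d c b
  - G b a c d + G b a d c + G b c a d - G b c d a - G b d a c + G b d c a
  + G c a b d - G c a d b - G c b a d + G c b d a + G c d a b - G c d b a
  - G d a b c + G d a c b + G d b a c - G d b c a - G d c a b + G d c b a.
Proof.
move=> a b c d; have vE k : v k = v (inord k) by rewrite inord_val.
under eq_bigr => s _ do rewrite (vE (s 0)) (vE (s 1)) (vE (s 2%:R)) (vE (s 3%:R)).
rewrite (sum_sign_perm4 (fun i j k l =>
  G (v (inord i)) (v (inord j)) (v (inord k)) (v (inord l)))).
by rewrite /a /b /c /d (vE 0) (vE 1) (vE 2%:R) (vE 3%:R).
Qed.

Definition mxval n r (A : 'M[form V r]_n) (p : V) (v : 'I_r -> V) : 'M[R]_n :=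
  \matrix_(a, b) A a b p v.

Lemma mxval_mxwedge11 n (A B : 'M[form V 1]_n) p (a b : V -> 'M[R]_n) v :
  (forall u : 'I_1 -> V, mxval A p u = a (u ord0)) ->
  (forall u : 'I_1 -> V, mxval B p u = b (u ord0)) ->
  mxval (mxwedge A B) p v = a (v 0) *m b (v 1) - a (v 1) *m b (v 0).
Proof.
move=> Aa Bb; apply/matrixP => i j; rewrite [LHS]mxE /mxwedge mxE.
have AE k l u : A k l p u = a (u ord0) k l by rewrite -Aa mxE.
have BE k l u : B k l p u = b (u ord0) k l by rewrite -Bb mxE.
transitivity (\sum_c (a (v 0) i c * b (v 1) c j - a (v 1) i c * b (v 0) c j)).
  apply: eq_bigr => c _; rewrite /wedge muln1 invr1 mul1r.
  rewrite -(sum_perm_vec2 (fun x y => a x i c * b y c j)).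
  apply: eq_bigr => s _; rewrite AE BE.
  congr (_ * (a (v (s _)) _ _ * b (v (s _)) _ _)); exact: val_inj.
by rewrite big_split /= sumrN; move: (a _) (a _) (b _) (b _) => *; rewrite !mxE.
Qed.

(** Exchanging the sum over tau, from the Pfaffian, with the sum over sigma, from
    the wedge product, leaves Pfaffians of matrices of values. *)
Lemma sum_pfaff_wedge r s (A : 'M[form V r]_4) (B : 'M[form V s]_4) p v :
  \sum_(tau : 'S_4) (-1) ^+ tau *
    wedge (A (tau 0) (tau 1)) (B (tau 2%:R) (tau 3%:R)) p v =
  ((r`! * s`!)%:R)^-1 * \sum_(sigma : 'S_(r + s)) (-1) ^+ sigma *
    pfaff (mxval A p (fun i => v (sigma (lshift s i))))
          (mxval B p (fun j => v (sigma (rshift r j)))).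
Proof.
rewrite /wedge; set k := _^-1.
transitivity (\sum_(tau : 'S_4) \sum_(sigma : 'S_(r + s))
  k * ((-1) ^+ sigma * ((-1) ^+ tau *
    (A (tau 0) (tau 1) p (fun i => v (sigma (lshift s i))) *
     B (tau 2%:R) (tau 3%:R) p (fun j => v (sigma (rshift r j))))))).
  apply: eq_bigr => tau _; rewrite mulrCA mulr_sumr mulr_sumr.
  apply: eq_bigr => sigma _; congr (_ * _); exact: mulrCA.
rewrite exchange_big /= mulr_sumr; apply: eq_bigr => sigma _.
rewrite -mulr_sumr -mulr_sumr; congr (_ * (_ * _)).
by apply: eq_bigr => tau _; congr (_ * (_ * _)); rewrite mxE.
Qed.

Lemma sum_pfaff_wedge_opp r s (A : 'M[form V r]_4) (B : 'M[form V s]_4) p v :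
  \sum_(tau : 'S_4) (-1) ^+ tau *
    wedge (A (tau 2%:R) (tau 3%:R)) (B (tau 0) (tau 1)) p v =
  ((r`! * s`!)%:R)^-1 * \sum_(sigma : 'S_(r + s)) (-1) ^+ sigma *
    pfaff (mxval A p (fun i => v (sigma (lshift s i))))
          (mxval B p (fun j => v (sigma (rshift r j)))).
Proof.
rewrite /wedge; set k := _^-1.
transitivity (\sum_(tau : 'S_4) \sum_(sigma : 'S_(r + s))
  k * ((-1) ^+ sigma * ((-1) ^+ tau *
    (B (tau 0) (tau 1) p (fun j => v (sigma (rshift r j))) *
     A (tau 2%:R) (tau 3%:R) p (fun i => v (sigma (lshift s i))))))).
  apply: eq_bigr => tau _; rewrite mulrCA mulr_sumr mulr_sumr.
  apply: eq_bigr => sigma _; congr (_ * _); rewrite mulrCA.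
  by congr (_ * (_ * _)); rewrite mulrC.
rewrite exchange_big /= mulr_sumr; apply: eq_bigr => sigma _.
rewrite -mulr_sumr -mulr_sumr pfaffC; congr (_ * (_ * _)).
by apply: eq_bigr => tau _; congr (_ * (_ * _)); rewrite mxE.
Qed.

Section Values.
(* T is meant for the tangent vectors, on which alone the curvature is known. *)
Variables (T : V -> Prop) (p : V).

Lemma sum_pfaff_perm11 (A B : 'M[form V 1]_4) (a b : V -> 'M[R]_4) v :
  (forall u : 'I_1 -> V, mxval A p u = a (u ord0)) ->
  (forall u : 'I_1 -> V, mxval B p u = b (u ord0)) ->
  ((1`! * 1`!)%:R)^-1 * \sum_(sigma : 'S_(1 + 1)) (-1) ^+ sigma *
    pfaff (mxval A p (fun i => v (sigma (lshift 1 i))))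
          (mxval B p (fun j => v (sigma (rshift 1 j)))) =
  pfaff (a (v 0)) (b (v 1)) - pfaff (a (v 1)) (b (v 0)).
Proof.
move=> Aa Bb; rewrite muln1 invr1 mul1r.
rewrite -(sum_perm_vec2 (fun x y => pfaff (a x) (b y))).
apply: eq_bigr => s _; rewrite Aa Bb; congr (_ * pfaff (a (v (s _))) (b (v (s _)))).
  exact: val_inj.
exact: val_inj.
Qed.

Lemma sum_pfaff_perm12 (A : 'M[form V 1]_4) (B : 'M[form V 2]_4)
    (a : V -> 'M[R]_4) (F : V -> V -> 'M[R]_4) v :
  (forall u : 'I_1 -> V, mxval A p u = a (u ord0)) ->
  (forall u : 'I_2 -> V, (forall i, T (u i)) -> mxval B p u = F (u 0) (u 1)) ->
  (forall x y, F x y = - F y x) -> (forall i, T (v i)) ->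
  ((1`! * 2`!)%:R)^-1 * \sum_(sigma : 'S_(1 + 2)) (-1) ^+ sigma *
    pfaff (mxval A p (fun i => v (sigma (lshift 2 i))))
          (mxval B p (fun j => v (sigma (rshift 1 j)))) =
  pfaff (a (v 0)) (F (v 1) (v 2%:R)) - pfaff (a (v 1)) (F (v 0) (v 2%:R))
  + pfaff (a (v 2%:R)) (F (v 0) (v 1)).
Proof.
move=> Aa BF FC Tv.
transitivity (2^-1 * \sum_(s : 'S_3) (-1) ^+ s *
   pfaff (a (v (s 0))) (F (v (s 1)) (v (s 2%:R)))).
  congr (_ * _); apply: eq_bigr => s _; rewrite Aa BF; last by move=> i; exact: Tv.
  congr (_ * pfaff (a (v (s _))) (F (v (s _)) (v (s _)))); exact: val_inj.
rewrite (sum_perm_vec3 (fun x y z => pfaff (a x) (F y z))) /=.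
rewrite (FC (v 2%:R) (v 1)) (FC (v 2%:R) (v 0)) (FC (v 1) (v 0)) !pfaffNr.
by field.
Qed.

Lemma sum_pfaff_perm22 (A B : 'M[form V 2]_4) (F : V -> V -> 'M[R]_4) v :
  (forall u : 'I_2 -> V, (forall i, T (u i)) -> mxval A p u = F (u 0) (u 1)) ->
  (forall u : 'I_2 -> V, (forall i, T (u i)) -> mxval B p u = F (u 0) (u 1)) ->
  (forall x y, F x y = - F y x) -> (forall i, T (v i)) ->
  ((2`! * 2`!)%:R)^-1 * \sum_(sigma : 'S_(2 + 2)) (-1) ^+ sigma *
    pfaff (mxval A p (fun i => v (sigma (lshift 2 i))))
          (mxval B p (fun j => v (sigma (rshift 2 j)))) =
  2 * (pfaff (F (v 0) (v 1)) (F (v 2%:R) (v 3%:R))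
     - pfaff (F (v 0) (v 2%:R)) (F (v 1) (v 3%:R))
     + pfaff (F (v 0) (v 3%:R)) (F (v 1) (v 2%:R))).
Proof.
move=> AF BF FC Tv.
transitivity (4^-1 * \sum_(s : 'S_4) (-1) ^+ s *
   pfaff (F (v (s 0)) (v (s 1))) (F (v (s 2%:R)) (v (s 3%:R)))).
  congr (_ * _); apply: eq_bigr => s _.
  rewrite AF; last by move=> i; exact: Tv.
  rewrite BF; last by move=> i; exact: Tv.
  congr (_ * pfaff (F (v (s _)) (v (s _))) (F (v (s _)) (v (s _)))); exact: val_inj.
rewrite (sum_perm_vec4 (fun x y z t => pfaff (F x y) (F z t))) /=.
move: (v 0) (v 1) (v 2%:R) (v 3%:R) => x y z t.
rewrite (FC y x) (FC z x) (FC t x) (FC z y) (FC t y) (FC t z).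
rewrite !(pfaffNl, pfaffNr) !opprK.
rewrite (pfaffC (F z t) (F x y)) (pfaffC (F y t) (F x z)) (pfaffC (F y z) (F x t)).
by field.
Qed.

End Values.

End WedgeEvaluation.

(** * The invariant representatives *)

Section InvariantRepresentatives.
Context {R : realType}.
Local Notation G := (@SO R 4).
Local Notation kpf := ((32 * pi ^+ 2)^-1 : R).

(** The values at the identity of the four nonzero components. The factor 2 comes
    with the trilinear form [pfaff3], which is half of pfaff A [B, C]. *)
Definition cochain03 (u : 'I_3 -> ambPG R 4 0) : R :=
  - 2 * kpf * pfaff3_cochain (pr 0) u.

Definition cochain12 (u : 'I_2 -> ambPG R 4 1) : R :=
  - kpf * pfaff_cochain (pr 0) (pr 1) u.

Definition cochain13 (u : 'I_3 -> ambPG R 4 1) : R :=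
  - 2 * kpf * pfaff3_cochain (fun x => pr 1 x - pr 0 x) u.

Definition cochain22 (u : 'I_2 -> ambPG R 4 2) : R :=
  - kpf * pfaff_cochain (fun x => pr 1 x - pr 0 x) (fun x => pr 2%:R x - pr 0 x) u.

Lemma mxval_theta q (i : 'I_q.+1) p (u : 'I_1 -> ambPG R 4 q) : PG G p ->
  mxval (theta i) p u = pr i (ltransPG p (u ord0)).
Proof. by move=> Gp; apply/matrixP => a b; rewrite mxE thetaE. Qed.

Lemma TE03E : form_eq (PG G (q := 0)) (@TE03 R) (inv_form cochain03).
Proof.
move=> p v Gp Tv; rewrite /TE03 sum_pfaff_wedge.
pose a u := pr 0 (ltransPG p u).
have aE (u : 'I_1 -> ambPG R 4 0) : mxval (theta 0) p u = a (u ord0).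
  exact: mxval_theta.
rewrite (sum_pfaff_perm12 (T := fun=> True)
  (F := fun x y => commutator (a x) (a y)) aE) //.
- rewrite /inv_form /cochain03 /pfaff3_cochain.
  have sa i : skew (a (v i)) by exact: tangent_PG_skew.
  rewrite !skew_part_id; try exact: sa.
  rewrite -!/(a _) (pfaff3_alternating_sum (sa _) (sa _) (sa _)).
  by move: pi (lt0r_neq0 (@pi_gt0 R)) => P P0; field.
- by move=> u _; exact: mxval_mxwedge11.
- by move=> x y; exact: commutatorC.
Qed.

Lemma TE12E : form_eq (PG G (q := 1)) (@TE12 R) (inv_form cochain12).
Proof.
move=> p v Gp Tv; rewrite /TE12.
under eq_bigr => tau _ do rewrite mulrDr.
rewrite big_split /= sum_pfaff_wedge sum_pfaff_wedge_opp.
pose a i u := pr i (ltransPG p u).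
have aE i (u : 'I_1 -> ambPG R 4 1) : mxval (theta i) p u = a i (u ord0).
  exact: mxval_theta.
rewrite (sum_pfaff_perm11 _ (aE 0) (aE 1)).
rewrite /inv_form /cochain12 /pfaff_cochain -!/(a _ _).
by move: pi (lt0r_neq0 (@pi_gt0 R)) => P P0; field.
Qed.

End InvariantRepresentatives.

(** * Integration over simplices *)

Section Integrals.
Context {R : realType}.
Local Notation mu := (@lebesgue_measure R).

Lemma Rintegral_deriv_poly (p : {poly R}) :
  \int[mu]_(t in `[0, 1]) (p^`()).[t] = p.[1] - p.[0].
Proof.
rewrite /Rintegral (@continuous_FTC2 R (horner p^`()) (horner p)) //.
- by apply: continuous_subspaceT; exact: continuous_horner.
- split=> [x _||]; first by case: (is_derive_poly p x).
    by apply: cvg_at_right_filter; exact: continuous_horner.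
  by apply: cvg_at_left_filter; exact: continuous_horner.
- by move=> x _; rewrite derive1E (@derive_val _ _ _ _ _ _ _ (is_derive_poly p x)).
Qed.

(** All integrands over the segment have degree at most 2. *)
Lemma Rintegral_quadratic (a b c : R) :
  \int[mu]_(t in `[0, 1]) (a + b * t + c * t ^+ 2) = a + b / 2 + c / 3.
Proof.
pose p : {poly R} := a *: 'X + (b / 2) *: 'X^2 + (c / 3) *: 'X^3.
transitivity (\int[mu]_(t in `[0, 1]) (p^`()).[t]).
  apply: eq_Rintegral => t _; rewrite /p !(derivD, derivZ, derivXn, derivX) !hornerE /=.
  by field.
by rewrite Rintegral_deriv_poly /p !hornerE /=; field.
Qed.

Lemma Rintegral_segment_cst (c s : R) : 0 <= s ->
  \int[mu]_(t in `[0, s]) c = c * s.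
Proof.
rewrite Rintegral_cst //= lebesgue_measure_itv /= lte_fin le_eqVlt.
by move=> /predU1P[<-|->]; rewrite ?ltxx /= ?subr0.
Qed.

Lemma eq_simplex_integral q s (F F' : seq R -> R) :
  (forall l, size l = q -> F l = F' l) ->
  simplex_integral q s F = simplex_integral q s F'.
Proof.
elim: q s F F' => [|q IH] s F F' FF' /=; first exact: FF'.
apply: eq_Rintegral => t _; apply: IH => l lq; apply: FF'.
by rewrite /= lq.
Qed.

Lemma simplex_integral0 q s : simplex_integral q s (fun=> 0 : R) = 0.
Proof.
elim: q s => [//|q IH] s /=.
transitivity (\int[mu]_(t in `[0%R, s]) (0 : R)); first by apply: eq_Rintegral.
by rewrite Rintegral_cst //= mul0r.
Qed.

Lemma simplex_integral1 (a b c : R) :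
  simplex_integral 1 1 (fun l => let t := head 0 l in a + b * t + c * t ^+ 2) =
  a + b / 2 + c / 3.
Proof. exact: Rintegral_quadratic. Qed.

Lemma simplex_integral2 (c : R) : simplex_integral 2 1 (fun=> c) = c / 2.
Proof.
rewrite /=; transitivity (\int[mu]_(t in `[0, 1]) (c + (- c) * t + 0 * t ^+ 2)).
  apply: eq_Rintegral => t; rewrite inE /= in_itv /= => /andP[_ t1].
  by rewrite Rintegral_segment_cst ?subr_ge0 //; ring.
by rewrite Rintegral_quadratic; field.
Qed.

End Integrals.

Section FibreIntegration.
Context {R : realType} {n : nat}.
Local Notation G := (@SO R n).

(** The arguments at which fibre integration evaluates a form. *)
Definition fibre_vec m q r (e : (q + r)%N = m) (v : 'I_r -> ambPG R n q)
    (k : 'I_m) : ambDPG R n q :=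
  match fintype.split (cast_ord (esym e) k) with
  | inl i => (simplex_dir i, 0)
  | inr j => (0, v j)
  end.

Lemma fibre_vec_dir m q r (e : (q + r)%N = m) v (k : 'I_m) (i : 'I_q) :
  k = i :> nat -> fibre_vec e v k = (simplex_dir i, 0).
Proof.
move=> ki; rewrite /fibre_vec; case: splitP => j /= kj.
  by congr (simplex_dir _, _); apply: val_inj; rewrite /= -kj ki.
by have := ltn_ord i; rewrite -ki kj ltnNge leq_addr.
Qed.

Lemma fibre_vec_base m q r (e : (q + r)%N = m) v (k : 'I_m) (j : 'I_r) :
  k = (q + j)%N :> nat -> fibre_vec e v k = (0, v j).
Proof.
move=> kj; rewrite /fibre_vec; case: splitP => i /= ki.
  by have := ltn_ord i; rewrite -ki kj ltnNge leq_addr.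
congr (0, v _); apply: val_inj; apply/eqP.
by rewrite -(eqn_add2l q) -kj /= -ki.
Qed.

Lemma I_DeltaE m (alpha : forall q, form (ambDPG R n q) m) q r
    (e : (q + r)%N = m) (g : ambPG R n q) v :
  I_Delta alpha q r g v = simplex_integral q 1 (fun l =>
    alpha q ((barycentric q l, g) : ambDPG R n q) (fibre_vec e v)).
Proof.
rewrite /I_Delta; case: eqP => [e'|//]; rewrite (eq_irrelevance e' e).
by [].
Qed.

Lemma I_Delta_off m (alpha : forall q, form (ambDPG R n q) m) q r :
  (q + r)%N <> m -> I_Delta alpha q r = zero_form r.
Proof. by rewrite /I_Delta; case: eqP. Qed.

Lemma barycentric_DPG q l (g : ambPG R n q) : size l = q -> PG G g ->
  DPG G ((barycentric q l, g) : ambDPG R n q).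
Proof.
move=> lq Gg; split => //; rewrite /bary /=.
under eq_bigr do rewrite mxE.
transitivity (\sum_(t <- (1 - \sum_(t <- l) t) :: l) t).
  by rewrite [RHS](big_nth 0) /= lq big_mkord.
by rewrite big_cons subrK.
Qed.

Lemma simplex_dir_sum q (i : 'I_q) : \sum_j (@simplex_dir R q i) 0 j = 0.
Proof.
under eq_bigr do rewrite !mxE eqxx /=.
rewrite big_split /= sumrN.
have one (k : 'I_q.+1) : \sum_(j < q.+1) (j == k)%:R = 1 :> R.
  by rewrite (bigD1 k) //= eqxx big1 ?addr0 // => j /negbTE->.
by rewrite !one subrr.
Qed.

Lemma pr0 q (i : 'I_q.+1) : pr i (0 : ambPG R n q) = 0.
Proof. by rewrite -(scale0r (0 : ambPG R n q)) prZ scale0r. Qed.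

Lemma fibre_vec_tangent m q r (e : (q + r)%N = m) l (g : ambPG R n q) v k :
  size l = q -> PG G g -> (forall j, tangent (PG G (q := q)) g (v j)) ->
  tangent (DPG G (q := q)) ((barycentric q l, g) : ambDPG R n q) (fibre_vec e v k).
Proof.
move=> lq Gg Tv; have [bl _] := barycentric_DPG lq Gg.
rewrite /fibre_vec; case: splitP => j _; apply: tangent_DPG => //=.
- have -> : 0 = mulPG g (0 : ambPG R n q).
    by apply: pr_inj => i; rewrite pr_mulPG !pr0 mulmx0.
  by apply: tangent_PG => // i; rewrite /skew pr0 linear0 oppr0.
- exact: simplex_dir_sum.
- by rewrite big1 // => i _; rewrite mxE.
Qed.

End FibreIntegration.

(** * Fibre components of the two cochains *)

Section CurvatureValues.
Context {R : realType}.
Local Notation G := (@SO R 4).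
Local Notation kpf := ((32 * pi ^+ 2)^-1 : R).
Local Notation mu := (@lebesgue_measure R).

Section General.
Context {q : nat}.
Local Notation DPGq := (ambDPG R 4 q).
Implicit Types (x : DPGq).

Lemma mxval_connection x (u : 'I_1 -> DPGq) : DPG G x ->
  mxval (connection q) x u = conn x (u ord0).
Proof. by move=> Gx; apply/matrixP => a b; rewrite mxE connectionE. Qed.

Lemma mxval_curvature x (u : 'I_2 -> DPGq) : DPG G x ->
  (forall i, tangent (DPG G (q := q)) x (u i)) ->
  mxval (curvature G q) x u = curv x (u 0) (u 1).
Proof.
move=> Gx Tu; apply/matrixP => a b.
rewrite /curv [in RHS]mxE [X in _ = X + _]mxE /curvature /mxform_add 2!mxE; congr (_ + _).
  rewrite /mxext_diff mxE ext_diff_connection //.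
  rewrite summxE [X in _ = _ + X]mxE summxE; congr (_ - _).
    by apply: eq_bigr => i _; move: (pr i _) (pr i _) => M N; rewrite !mxE.
  apply: eq_bigr => i _.
  by move: (_ *m _ - _ *m _) => M; rewrite [RHS]mxE.
have wE := mxval_mxwedge11 u (fun u => mxval_connection u Gx)
  (fun u => mxval_connection u Gx).
by have := congr1 (fun M : 'M[R]_4 => M a b) wE; rewrite mxE.
Qed.

Lemma curvC x (v w : DPGq) : curv x v w = - curv x w v.
Proof.
rewrite /curv 2!opprD -!sumrN; congr (_ + _ + _); last by rewrite opprB.
  by apply: eq_bigr => i _; rewrite opprB.
by apply: eq_bigr => i _; rewrite opprK -scalerN opprB.
Qed.

Lemma PfOmegaE x (v : 'I_4 -> DPGq) :
  DPG G x -> (forall i, tangent (DPG G (q := q)) x (v i)) ->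
  PfOmega q x v = 2 * kpf *
   (pfaff (curv x (v 0) (v 1)) (curv x (v 2%:R) (v 3%:R))
  - pfaff (curv x (v 0) (v 2%:R)) (curv x (v 1) (v 3%:R))
  + pfaff (curv x (v 0) (v 3%:R)) (curv x (v 1) (v 2%:R))).
Proof.
move=> Gx Tv; rewrite /PfOmega /Pf sum_pfaff_wedge.
have F u (Tu : forall i, tangent (DPG G (q := q)) x (u i)) := mxval_curvature Gx Tu.
rewrite (sum_pfaff_perm22 F F (curvC x) Tv).
by rewrite mulrA [_ * 2]mulrC.
Qed.

(** The integrand is a quadratic polynomial in t: t Omega contributes with
    weight 2 * 1/2, and (t^2 - t) [theta, theta] / 2 with weight
    2 * (1/3 - 1/2). *)
Lemma TPfE x (v : 'I_3 -> DPGq) :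
  DPG G x -> (forall i, tangent (DPG G (q := q)) x (v i)) ->
  let c i := conn x (v i) in
  TPf q x v = kpf *
   ((pfaff (c 0) (curv x (v 1) (v 2%:R)) - pfaff (c 1) (curv x (v 0) (v 2%:R))
      + pfaff (c 2%:R) (curv x (v 0) (v 1)))
  - (pfaff (c 0) (commutator (c 1) (c 2%:R)) - pfaff (c 1) (commutator (c 0) (c 2%:R))
      + pfaff (c 2%:R) (commutator (c 0) (c 1))) / 3).
Proof.
move=> Gx Tv c; rewrite /TPf.
set al := (X in X - _ / 3); set be := (X in _ - X / 3).
transitivity (2 * \int[mu]_(t in `[0, 1])
    (0 + kpf * (al - be) * t + kpf * be * t ^+ 2)).
  congr (_ * _); apply: eq_Rintegral => t _; rewrite /Pf sum_pfaff_wedge.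
  pose F y z := t *: curv x y z + (t * (t - 1)) *: commutator (conn x y) (conn x z).
  have FE (u : 'I_2 -> DPGq) : (forall i, tangent (DPG G (q := q)) x (u i)) ->
      mxval (mxform_add (mxform_scale t (curvature G q))
        (mxform_scale (t * (t - 1)) (mxwedge (connection q) (connection q)))) x u =
      F (u 0) (u 1).
    move=> Tu; rewrite /F -(mxval_curvature Gx Tu) /commutator.
    have <- := mxval_mxwedge11 u (fun u => mxval_connection u Gx)
      (fun u => mxval_connection u Gx).
    by apply/matrixP => a b; rewrite !mxE.
  have FC y z : F y z = - F z y.
    by rewrite /F curvC commutatorC !scalerN opprD.
  rewrite (sum_pfaff_perm12 (fun u => mxval_connection u Gx) FE FC Tv).
  have FP A y z : pfaff A (F y z) = t * pfaff A (curv x y z) +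
      t * (t - 1) * pfaff A (commutator (conn x y) (conn x z)).
    by rewrite pfaffDr !pfaffZr.
  rewrite (FP (conn x (v 0))) (FP (conn x (v 1))) (FP (conn x (v 2%:R))).
  have polyE (k a1 a2 a3 b1 b2 b3 : R) :
      k * (t * a1 + t * (t - 1) * b1 - (t * a2 + t * (t - 1) * b2)
        + (t * a3 + t * (t - 1) * b3)) =
      0 + k * ((a1 - a2 + a3) - (b1 - b2 + b3)) * t + k * (b1 - b2 + b3) * t ^+ 2.
    by ring.
  exact: polyE.
have intE (k a b : R) : 2 * (0 + k * (a - b) / 2 + k * b / 3) = k * (a - b / 3).
  by field.
by rewrite Rintegral_quadratic intE.
Qed.

End General.

Section Fibre.
Context {q : nat} (b : 'rV[R]_q.+1) (g : ambPG R 4 q).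
Local Notation DPGq := (ambDPG R 4 q).
Local Notation x := ((b, g) : DPGq).
Local Notation dir s := ((s, 0) : DPGq).
Local Notation base v := ((0, v) : DPGq).
Implicit Types (s : 'rV[R]_q.+1) (v w : ambPG R 4 q).

Lemma ltransPG0 : ltransPG g 0 = 0.
Proof. by apply: pr_inj => i; rewrite pr_ltransPG !pr0 mulmx0. Qed.

Lemma conn_dir s : conn x (dir s) = 0.
Proof. by rewrite /conn big1 // => i _; rewrite /= ltransPG0 pr0 scaler0. Qed.

Lemma conn_base v : conn x (base v) = \sum_i b 0 i *: pr i (ltransPG g v).
Proof. by []. Qed.

(** The curvature has no component of degree 2 along the simplex. *)
Lemma curv_dir s s' : curv x (dir s) (dir s') = 0.
Proof.
rewrite /curv !conn_dir mulmx0 subrr addr0 !big1 ?subrr // => i _ /=;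
  by rewrite !ltransPG0 !pr0 ?mulmx0 ?subrr ?scaler0 ?subrr.
Qed.

Lemma curv_dir_base s v :
  curv x (dir s) (base v) = \sum_i s 0 i *: pr i (ltransPG g v).
Proof.
rewrite /curv conn_dir mul0mx mulmx0 subrr addr0 [X in _ - X]big1 ?subr0.
  by apply: eq_bigr => i _; rewrite /= mxE scale0r subr0.
by move=> i _; rewrite /= ltransPG0 pr0 mul0mx mulmx0 subrr scaler0.
Qed.

Lemma curv_base v w : curv x (base v) (base w) =
  commutator (conn x (base v)) (conn x (base w)) -
  \sum_i b 0 i *: commutator (pr i (ltransPG g v)) (pr i (ltransPG g w)).
Proof.
rewrite /curv [X in X - _]big1 ?sub0r 1?addrC // => i _ /=.
by rewrite !mxE !scale0r subrr.
Qed.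

End Fibre.

End CurvatureValues.

Section Components.
Context {R : realType}.
Local Notation G := (@SO R 4).
Local Notation kpf := ((32 * pi ^+ 2)^-1 : R).

Lemma I_Delta_TPf03 :
  form_eq (PG G (q := 0)) (I_Delta (@TPf R) 0 3) (inv_form cochain03).
Proof.
move=> g v Gg Tv; rewrite (I_DeltaE _ (erefl : (0 + 3)%N = 3%N)) /=.
have Gx := @barycentric_DPG R 4 0 [::] g erefl Gg.
rewrite TPfE //; last by move=> k; exact: fibre_vec_tangent.
set x := (_, _).
have fb k : fibre_vec (erefl : (0 + 3)%N = 3%N) v k = (0, v k).
  exact: fibre_vec_base.
have b1 : (barycentric 0 [::] : 'rV[R]_1) 0 0 = 1 by rewrite mxE /= big_nil subr0.
have cE k : conn x (0, v k) = pr 0 (ltransPG g (v k)).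
  by rewrite conn_base big_ord1 b1 scale1r.
have FE k l : curv x (0, v k) (0, v l) = 0.
  by rewrite curv_base !cE big_ord1 b1 scale1r subrr.
rewrite !fb !FE !cE !pfaff0r /inv_form /cochain03 /pfaff3_cochain.
have sa k : skew (pr 0 (ltransPG g (v k))) by exact: tangent_PG_skew.
rewrite !skew_part_id; try exact: sa.
rewrite (pfaff3_alternating_sum (sa _) (sa _) (sa _)).
by move: kpf (pfaff3 _ _ _) => *; field.
Qed.

Lemma big_ord2 (W : zmodType) (F : 'I_2 -> W) : \sum_i F i = F 0 + F 1.
Proof.
by rewrite !big_ord_recl big_ord0 addr0; congr (F _ + F _); apply: val_inj.
Qed.

Lemma big_ord3 (W : zmodType) (F : 'I_3 -> W) : \sum_i F i = F 0 + F 1 + F 2%:R.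
Proof.
rewrite !big_ord_recl big_ord0 addr0 addrA.
by congr (F _ + F _ + F _); apply: val_inj.
Qed.

Lemma fibre_bary1 t :
  (barycentric 1 [:: t] : 'rV[R]_2) 0 0 = 1 - t /\
  (barycentric 1 [:: t] : 'rV[R]_2) 0 1 = t.
Proof. by rewrite !mxE /= big_seq1. Qed.

Lemma simplex_dir1 (F : 'I_2 -> 'M[R]_4) :
  \sum_i (@simplex_dir R 1 0) 0 i *: F i = F 1 - F 0.
Proof.
by rewrite big_ord2 !mxE /= sub0r subr0 scaleN1r scale1r addrC.
Qed.

(** The connection vanishes along the simplex and the curvature contracted with
    d/dt is theta_1 - theta_0, so the integrand is affine in t. *)
Lemma I_Delta_TPf12 :
  form_eq (PG G (q := 1)) (I_Delta (@TPf R) 1 2) (inv_form cochain12).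
Proof.
move=> g v Gg Tv; rewrite (I_DeltaE _ (erefl : (1 + 2)%N = 3%N)).
pose a i k := pr i (ltransPG g (v k)).
pose c0 := - pfaff (a 0 0) (a 1 1 - a 0 1) + pfaff (a 0 1) (a 1 0 - a 0 0).
pose c1 := - pfaff (a 1 0) (a 1 1 - a 0 1) + pfaff (a 1 1) (a 1 0 - a 0 0).
transitivity (simplex_integral 1 1 (fun l => let t := head 0 l in
    kpf * c0 + (kpf * (c1 - c0)) * t + 0 * t ^+ 2)).
  apply: eq_simplex_integral => -[|t [|//]] //= _.
  have Gx := @barycentric_DPG R 4 1 [:: t] g erefl Gg.
  rewrite TPfE //; last by move=> k; exact: fibre_vec_tangent.
  set x := (_, _).
  have f0 : fibre_vec (erefl : (1 + 2)%N = 3%N) v 0 = (simplex_dir 0, 0).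
    exact: fibre_vec_dir.
  have f1 : fibre_vec (erefl : (1 + 2)%N = 3%N) v 1 = (0, v 0).
    exact: fibre_vec_base.
  have f2 : fibre_vec (erefl : (1 + 2)%N = 3%N) v 2%:R = (0, v 1).
    exact: fibre_vec_base.
  have [b0 b1] := fibre_bary1 t.
  rewrite f0 f1 f2 conn_dir !curv_dir_base !simplex_dir1 -!/(a _ _).
  rewrite !conn_base !big_ord2 b0 b1 -!/(a _ _).
  rewrite !pfaff0l /commutator !mul0mx !mulmx0 !subrr !pfaff0r.
  rewrite !(pfaffDl, pfaffZl) /c0 /c1.
  by move: kpf (pfaff (a 0 0) _) (pfaff (a 0 1) _) (pfaff (a 1 0) _) (pfaff (a 1 1) _)
    => *; field.
rewrite simplex_integral1 /inv_form /cochain12 /pfaff_cochain -!/(a _ _) /c0 /c1.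
rewrite !pfaffBr (pfaffC (a 0 1) (a 1 0)) (pfaffC (a 0 1) (a 0 0)).
rewrite (pfaffC (a 1 1) (a 1 0)) (pfaffC (a 1 1) (a 0 0)).
by move: kpf (pfaff _ _) (pfaff _ _) (pfaff _ _) (pfaff _ _) => *; field.
Qed.

End Components.

Section OtherComponents.
Context {R : realType}.
Local Notation G := (@SO R 4).
Local Notation kpf := ((32 * pi ^+ 2)^-1 : R).

(** Two of the three arguments are along the simplex. *)
Lemma I_Delta_TPf21 :
  form_eq (PG G (q := 2)) (I_Delta (@TPf R) 2 1) (zero_form 1).
Proof.
move=> g v Gg Tv; rewrite (I_DeltaE _ (erefl : (2 + 1)%N = 3%N)).
rewrite [RHS](_ : _ = simplex_integral 2 1 (fun=> 0)); last by rewrite simplex_integral0.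
apply: eq_simplex_integral => l l2.
have Gx := @barycentric_DPG R 4 2 l g l2 Gg.
rewrite TPfE //; last by move=> k; exact: fibre_vec_tangent.
have f0 : fibre_vec (erefl : (2 + 1)%N = 3%N) v 0 = (simplex_dir 0, 0).
  exact: fibre_vec_dir.
have f1 : fibre_vec (erefl : (2 + 1)%N = 3%N) v 1 = (simplex_dir 1, 0).
  exact: fibre_vec_dir.
rewrite f0 f1 !conn_dir curv_dir /commutator !mul0mx !mulmx0.
by rewrite !(pfaff0l, pfaff0r, subrr, addr0, mul0r, mulr0).
Qed.

Lemma I_Delta_TPf30 :
  form_eq (PG G (q := 3)) (I_Delta (@TPf R) 3 0) (zero_form 0).
Proof.
move=> g v Gg Tv; rewrite (I_DeltaE _ (erefl : (3 + 0)%N = 3%N)).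
rewrite [RHS](_ : _ = simplex_integral 3 1 (fun=> 0)); last by rewrite simplex_integral0.
apply: eq_simplex_integral => l l3.
have Gx := @barycentric_DPG R 4 3 l g l3 Gg.
rewrite TPfE //; last by move=> k; exact: fibre_vec_tangent.
have fk k : fibre_vec (erefl : (3 + 0)%N = 3%N) v k = (simplex_dir k, 0).
  exact: fibre_vec_dir.
rewrite !fk !conn_dir !pfaff0l.
by rewrite !(subrr, addr0, mul0r, mulr0).
Qed.

(** Over the vertex the connection is the Maurer-Cartan form, which is flat. *)
Lemma I_Delta_PfOmega04 :
  form_eq (PG G (q := 0)) (I_Delta (@PfOmega R) 0 4) (zero_form 4).
Proof.
move=> g v Gg Tv; rewrite (I_DeltaE _ (erefl : (0 + 4)%N = 4%N)) /=.
have Gx := @barycentric_DPG R 4 0 [::] g erefl Gg.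
rewrite PfOmegaE //; last by move=> k; exact: fibre_vec_tangent.
have fb k : fibre_vec (erefl : (0 + 4)%N = 4%N) v k = (0, v k).
  exact: fibre_vec_base.
have b1 : (barycentric 0 [::] : 'rV[R]_1) 0 0 = 1 by rewrite mxE /= big_nil subr0.
have FE k l : curv (barycentric 0 [::], g) (0, v k) (0, v l) = 0.
  by rewrite curv_base !conn_base !big_ord1 b1 !scale1r subrr.
by rewrite !fb !FE !pfaff0r !(subrr, addr0, mulr0).
Qed.

(** Between the two flat connections theta_0 and theta_1 the curvature on the
    group is - t (1 - t) [d, d'] with d = theta_1 - theta_0. *)
Lemma I_Delta_PfOmega13 :
  form_eq (PG G (q := 1)) (I_Delta (@PfOmega R) 1 3) (inv_form cochain13).
Proof.
move=> g v Gg Tv; rewrite (I_DeltaE _ (erefl : (1 + 3)%N = 4%N)).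
pose a i k := pr i (ltransPG g (v k)).
have sa i k : skew (a i k) by exact: tangent_PG_skew.
pose d k := a 1 k - a 0 k.
have sd k : skew (d k) by apply: skewB; exact: sa.
pose Q := pfaff3 (d 0) (d 1) (d 2%:R).
transitivity (simplex_integral 1 1 (fun l => let t := head 0 l in
    0 + (- 12 * kpf * Q) * t + (12 * kpf * Q) * t ^+ 2)).
  apply: eq_simplex_integral => -[|t [|//]] //= _.
  have Gx := @barycentric_DPG R 4 1 [:: t] g erefl Gg.
  rewrite PfOmegaE //; last by move=> k; exact: fibre_vec_tangent.
  have f0 : fibre_vec (erefl : (1 + 3)%N = 4%N) v 0 = (simplex_dir 0, 0).
    exact: fibre_vec_dir.
  have f1 : fibre_vec (erefl : (1 + 3)%N = 4%N) v 1 = (0, v 0).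
    exact: fibre_vec_base.
  have f2 : fibre_vec (erefl : (1 + 3)%N = 4%N) v 2%:R = (0, v 1).
    exact: fibre_vec_base.
  have f3 : fibre_vec (erefl : (1 + 3)%N = 4%N) v 3%:R = (0, v 2%:R).
    exact: fibre_vec_base.
  have [b0 b1] := fibre_bary1 t.
  have FE k l : curv (barycentric 1 [:: t], g) (0, v k) (0, v l) =
      (- (t * (1 - t))) *: commutator (d k) (d l).
    rewrite curv_base !conn_base !big_ord2 b0 b1 -!/(a _ _) /d /commutator.
    move: (a 0 k) (a 1 k) (a 0 l) (a 1 l) => A B C D.
    rewrite !(mulmxBl, mulmxBr, mulmxDl, mulmxDr) -!(scalemxAl, scalemxAr).
    move: (A *m C) (C *m A) (A *m D) (D *m A) (B *m C) (C *m B) (B *m D) (D *m B).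
    by move=> M1 M2 M3 M4 M5 M6 M7 M8; apply/matrixP => i j; rewrite !mxE; ring.
  rewrite f0 f1 f2 f3 !curv_dir_base !simplex_dir1 -!/(a _ _) -!/(d _) !FE !pfaffZr.
  have S := pfaff3_alternating_sum (sd 0) (sd 1) (sd 2%:R).
  have -> : forall k c x y z : R, 2 * k * (c * x - c * y + c * z) =
      2 * k * c * (x - y + z) by move=> *; ring.
  by rewrite S -/Q; move: kpf Q => *; ring.
rewrite simplex_integral1 /inv_form /cochain13 /pfaff3_cochain -!/(a _ _) -!/(d _).
rewrite !skew_part_id; try exact: sd.
by rewrite -/Q; move: kpf Q => *; field.
Qed.

Lemma simplex_dir2 (F : 'I_3 -> 'M[R]_4) :
  (\sum_i (@simplex_dir R 2 0) 0 i *: F i = F 1 - F 0) /\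
  (\sum_i (@simplex_dir R 2 1) 0 i *: F i = F 2%:R - F 0).
Proof.
rewrite !big_ord3 !mxE /= !(sub0r, subr0, scaleN1r, scale1r, subrr, scale0r, addr0).
by rewrite oppr0 !scale0r !addr0; split; rewrite addrC.
Qed.

(** Each curvature factor takes one of the two directions of the simplex, so the
    integrand is constant; the simplex has area 1/2. *)
Lemma I_Delta_PfOmega22 :
  form_eq (PG G (q := 2)) (I_Delta (@PfOmega R) 2 2) (inv_form cochain22).
Proof.
move=> g v Gg Tv; rewrite (I_DeltaE _ (erefl : (2 + 2)%N = 4%N)).
pose a i k := pr i (ltransPG g (v k)).
pose d i k := a i k - a 0 k.
pose c := pfaff (d 1 0) (d 2%:R 1) - pfaff (d 1 1) (d 2%:R 0).
transitivity (simplex_integral 2 1 (fun=> - 2 * kpf * c)).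
  apply: eq_simplex_integral => l l2.
  have Gx := @barycentric_DPG R 4 2 l g l2 Gg.
  rewrite PfOmegaE //; last by move=> k; exact: fibre_vec_tangent.
  have f0 : fibre_vec (erefl : (2 + 2)%N = 4%N) v 0 = (simplex_dir 0, 0).
    exact: fibre_vec_dir.
  have f1 : fibre_vec (erefl : (2 + 2)%N = 4%N) v 1 = (simplex_dir 1, 0).
    exact: fibre_vec_dir.
  have f2 : fibre_vec (erefl : (2 + 2)%N = 4%N) v 2%:R = (0, v 0).
    exact: fibre_vec_base.
  have f3 : fibre_vec (erefl : (2 + 2)%N = 4%N) v 3%:R = (0, v 1).
    exact: fibre_vec_base.
  rewrite f0 f1 f2 f3 curv_dir !curv_dir_base !(simplex_dir2 _).1 !(simplex_dir2 _).2.
  rewrite -!/(a _ _) -!/(d _ _) pfaff0l /c.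
  by move: kpf (pfaff _ _) (pfaff _ _) => *; ring.
rewrite simplex_integral2 /inv_form /cochain22 /pfaff_cochain -!/(a _ _) -!/(d _ _) -/c.
by move: kpf c => *; field.
Qed.

(** With three or more arguments along the simplex, one curvature factor has
    both of its arguments there. *)
Lemma I_Delta_PfOmega31 :
  form_eq (PG G (q := 3)) (I_Delta (@PfOmega R) 3 1) (zero_form 1).
Proof.
move=> g v Gg Tv; rewrite (I_DeltaE _ (erefl : (3 + 1)%N = 4%N)).
rewrite [RHS](_ : _ = simplex_integral 3 1 (fun=> 0)); last by rewrite simplex_integral0.
apply: eq_simplex_integral => l l3.
have Gx := @barycentric_DPG R 4 3 l g l3 Gg.
rewrite PfOmegaE //; last by move=> k; exact: fibre_vec_tangent.
have f0 : fibre_vec (erefl : (3 + 1)%N = 4%N) v 0 = (simplex_dir 0, 0).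
  exact: fibre_vec_dir.
have f1 : fibre_vec (erefl : (3 + 1)%N = 4%N) v 1 = (simplex_dir 1, 0).
  exact: fibre_vec_dir.
have f2 : fibre_vec (erefl : (3 + 1)%N = 4%N) v 2%:R = (simplex_dir 2%:R, 0).
  exact: fibre_vec_dir.
rewrite f0 f1 f2 !curv_dir !pfaff0l pfaff0r.
by rewrite !(subrr, addr0, mulr0).
Qed.

Lemma I_Delta_PfOmega40 :
  form_eq (PG G (q := 4)) (I_Delta (@PfOmega R) 4 0) (zero_form 0).
Proof.
move=> g v Gg Tv; rewrite (I_DeltaE _ (erefl : (4 + 0)%N = 4%N)).
rewrite [RHS](_ : _ = simplex_integral 4 1 (fun=> 0)); last by rewrite simplex_integral0.
apply: eq_simplex_integral => l l4.
have Gx := @barycentric_DPG R 4 4 l g l4 Gg.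
rewrite PfOmegaE //; last by move=> k; exact: fibre_vec_tangent.
have fk k : fibre_vec (erefl : (4 + 0)%N = 4%N) v k = (simplex_dir k, 0).
  exact: fibre_vec_dir.
rewrite !fk !curv_dir !pfaff0l.
by rewrite !(subrr, addr0, mulr0).
Qed.

End OtherComponents.

(** * The total complex of left-invariant forms *)

Section TotalComplex.
Context {R : realType}.
Local Notation G := (@SO R 4).

Lemma inv_form_eq q r (W W' : ('I_r -> ambPG R 4 q) -> R) :
  (forall A, (forall i k, skew (pr i (A k))) -> W A = W' A) ->
  form_eq (PG G (q := q)) (inv_form W) (inv_form W').
Proof.
by move=> WW' p v Gp Tv; apply: WW' => i k; exact: tangent_PG_skew.
Qed.

Lemma face_mulPG q (i : 'I_q.+2) (x a : ambPG R 4 q.+1) :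
  face i (mulPG x a) = mulPG (face i x) (face i a).
Proof. by apply: pr_inj => j; rewrite pr_face !pr_mulPG !pr_face. Qed.

Lemma face_ltransPG q (i : 'I_q.+2) (p v : ambPG R 4 q.+1) :
  face i (ltransPG p v) = ltransPG (face i p) (face i v).
Proof. by apply: pr_inj => j; rewrite pr_face !pr_ltransPG !pr_face. Qed.

Lemma face_PG q (i : 'I_q.+2) (p : ambPG R 4 q.+1) : PG G p -> PG G (face i p).
Proof. by move=> Gp j; rewrite pr_face; exact: Gp. Qed.

Lemma face_tangent q (i : 'I_q.+2) (p v : ambPG R 4 q.+1) : PG G p ->
  tangent (PG G (q := q.+1)) p v ->
  tangent (PG G (q := q)) (face i p) (face i v).
Proof.
move=> Gp Tv; rewrite -(mulPGK v Gp) face_mulPG.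
apply: tangent_PG; first exact: face_PG.
by move=> j; rewrite pr_face; exact: tangent_PG_skew.
Qed.

Lemma diff_face q (i : 'I_q.+2) (p v : ambPG R 4 q.+1) : 'd (face i) p v = face i v.
Proof.
apply: (diff_linear PG_coordinates) => c y z.
by apply: pr_inj => j; rewrite prD prZ !pr_face prD prZ.
Qed.

Lemma d'_inv_form q r (w : form (ambPG R 4 q) r) W :
  form_eq (PG G (q := q)) w (inv_form W) ->
  form_eq (PG G (q := q.+1)) (d' w) (inv_form (face_sum W)).
Proof.
move=> wW p v Gp Tv; apply: eq_bigr => i _; congr (_ * _).
rewrite /pullback wW; last by move=> k; rewrite diff_face; exact: face_tangent.
  by congr W; apply: funext => k; rewrite diff_face face_ltransPG.
exact: face_PG.
Qed.

Lemma d''_inv_form q r (w : form (ambPG R 4 q) r) W :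
  multilinear_form W -> alternating_form W ->
  form_eq (PG G (q := q)) w (inv_form W) ->
  form_eq (PG G (q := q)) (d'' G w) (inv_form (fun A => (-1) ^+ q * lie_diff W A)).
Proof.
by move=> WL WA wW p v Gp Tv; rewrite /d'' (ext_diff_inv_form WL WA wW).
Qed.

(** Left-invariant cochains of the double complex, given at the identity. *)
Definition lie_cochain := forall q r, ('I_r -> ambPG R 4 q) -> R.

Definition lie_total_diff (W : lie_cochain) : lie_cochain := fun q r A =>
  (match q return ('I_r -> ambPG R 4 q) -> R with
   | 0%N => fun=> 0
   | q'.+1 => face_sum (W q' r)
   end A) +
  (match r return ('I_r -> ambPG R 4 q) -> R with
   | 0%N => fun=> 0
   | r'.+1 => fun A => (-1) ^+ q * lie_diff (W q r') A
   end A).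

Lemma total_diff_inv_form (c : @cochain R 4) (W : lie_cochain) :
  (forall q r, multilinear_form (W q r) /\ alternating_form (W q r)) ->
  (forall q r, form_eq (PG G (q := q)) (c q r) (inv_form (W q r))) ->
  forall q r, form_eq (PG G (q := q)) (@total_diff R 4 G c q r)
    (inv_form (@lie_total_diff W q r)).
Proof.
move=> WA cW q r p v Gp Tv; rewrite /total_diff /inv_form /lie_total_diff.
congr (_ + _).
  by case: q p v Gp Tv => [//|q] p v Gp Tv; rewrite (d'_inv_form (cW q r)).
case: r v Tv => [//|r] v Tv; have [WL Wa] := WA q r.
by rewrite (d''_inv_form WL Wa (cW q r)).
Qed.

Lemma total_cochain_inv_form m (c : @cochain R 4) (W : lie_cochain) :
  (forall q r, multilinear_form (W q r) /\ alternating_form (W q r)) ->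
  (forall q r, form_eq (PG G (q := q)) (c q r) (inv_form (W q r))) ->
  (forall q r, (q + r)%N != m -> forall A, W q r A = 0) ->
  total_cochain G m c.
Proof.
move=> WA cW W0 q r; have [WL Wa] := WA q r; split.
  by exists (inv_form (W q r)); exact: inv_form_smooth_extension.
by move=> qr p v Gp Tv; rewrite cW // /inv_form W0.
Qed.

Definition TE_lie : lie_cochain := fun q r =>
  match q, r return ('I_r -> ambPG R 4 q) -> R with
  | 0%N, 3%N => cochain03
  | 1%N, 2%N => cochain12
  | _, _ => fun=> 0
  end.

Definition Ebar_lie : lie_cochain := fun q r =>
  match q, r return ('I_r -> ambPG R 4 q) -> R with
  | 1%N, 3%N => cochain13
  | 2%N, 2%N => cochain22
  | _, _ => fun=> 0
  end.

Arguments TE_lie : clear implicits.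
Arguments Ebar_lie : clear implicits.

Lemma multilinear_scale q r k (W : ('I_r -> ambPG R 4 q) -> R) :
  multilinear_form W -> multilinear_form (fun u => k * W u).
Proof. by move=> WL v i c x y; rewrite WL; ring. Qed.

Lemma alternating_scale q r k (W : ('I_r -> ambPG R 4 q) -> R) :
  alternating_form W -> alternating_form (fun u => k * W u).
Proof. by move=> WA v i j ij vij; rewrite (WA v i j) // mulr0. Qed.

Lemma zero_multilinear_alternating q r :
  multilinear_form (fun _ : 'I_r -> ambPG R 4 q => 0 : R) /\
  alternating_form (fun _ : 'I_r -> ambPG R 4 q => 0 : R).
Proof. by split => // v i k x y; rewrite mulr0 addr0. Qed.

Lemma pr_linear_map q (i : 'I_q.+1) : linear_map (pr i : ambPG R 4 q -> _).
Proof. by move=> k x y; exact: pr_linear. Qed.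

Lemma pr_sub_linear_map q (i j : 'I_q.+1) :
  linear_map (fun x : ambPG R 4 q => pr i x - pr j x).
Proof.
by move=> k x y; rewrite !pr_linear scalerBr opprD addrACA.
Qed.

Lemma TE_lie_form q r : multilinear_form (TE_lie q r) /\ alternating_form (TE_lie q r).
Proof.
case: q r => [|[|q]] [|[|[|[|r]]]]; try exact: zero_multilinear_alternating.
  split; first by apply: multilinear_scale; apply: pfaff3_cochain_multilinear;
    exact: pr_linear_map.
  by apply: alternating_scale; exact: pfaff3_cochain_alternating.
split; first by apply: multilinear_scale; apply: pfaff_cochain_multilinear;
  exact: pr_linear_map.
by apply: alternating_scale; exact: pfaff_cochain_alternating.
Qed.

Lemma Ebar_lie_form q r :
  multilinear_form (Ebar_lie q r) /\ alternating_form (Ebar_lie q r).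
Proof.
case: q r => [|[|[|q]]] [|[|[|[|r]]]]; try exact: zero_multilinear_alternating.
  split; first by apply: multilinear_scale; apply: pfaff3_cochain_multilinear;
    exact: pr_sub_linear_map.
  by apply: alternating_scale; exact: pfaff3_cochain_alternating.
split; first by apply: multilinear_scale; apply: pfaff_cochain_multilinear;
  exact: pr_sub_linear_map.
by apply: alternating_scale; exact: pfaff_cochain_alternating.
Qed.

Lemma TE_lie_off q r : (q + r)%N != 3%N -> forall A, TE_lie q r A = 0.
Proof. by case: q r => [|[|q]] [|[|[|[|r]]]]. Qed.

Lemma Ebar_lie_off q r : (q + r)%N != 4%N -> forall A, Ebar_lie q r A = 0.
Proof. by case: q r => [|[|[|q]]] [|[|[|[|r]]]]. Qed.

Lemma TE_inv_form q r : form_eq (PG G (q := q)) (@TE R q r) (inv_form (TE_lie q r)).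
Proof.
case: q r => [|[|q]] [|[|[|[|r]]]] //; [exact: TE03E|exact: TE12E].
Qed.

Lemma I_Delta_TPf_inv_form q r :
  form_eq (PG G (q := q)) (I_Delta (@TPf R) q r) (inv_form (TE_lie q r)).
Proof.
have [e|ne] := eqVneq (q + r)%N 3%N; last first.
  rewrite I_Delta_off; last exact/eqP.
  by move=> p v _ _; rewrite /inv_form TE_lie_off.
case: q r e => [|[|[|[|q]]]] r //.
- move=> e; have -> : r = 3%N by lia.
  exact: I_Delta_TPf03.
- move=> e; have -> : r = 2%N by lia.
  exact: I_Delta_TPf12.
- move=> e; have -> : r = 1%N by lia.
  exact: I_Delta_TPf21.
- move=> e; have -> : r = 0%N by lia.
  exact: I_Delta_TPf30.
Qed.

Lemma I_Delta_PfOmega_inv_form q r :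
  form_eq (PG G (q := q)) (I_Delta (@PfOmega R) q r) (inv_form (Ebar_lie q r)).
Proof.
have [e|ne] := eqVneq (q + r)%N 4%N; last first.
  rewrite I_Delta_off; last exact/eqP.
  by move=> p v _ _; rewrite /inv_form Ebar_lie_off.
case: q r e => [|[|[|[|[|q]]]]] r //.
- move=> e; have -> : r = 4%N by lia.
  exact: I_Delta_PfOmega04.
- move=> e; have -> : r = 3%N by lia.
  exact: I_Delta_PfOmega13.
- move=> e; have -> : r = 2%N by lia.
  exact: I_Delta_PfOmega22.
- move=> e; have -> : r = 1%N by lia.
  exact: I_Delta_PfOmega31.
- move=> e; have -> : r = 0%N by lia.
  exact: I_Delta_PfOmega40.
Qed.

Lemma face_sum_scale q r k (W : ('I_r -> ambPG R 4 q) -> R) A :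
  face_sum (fun u => k * W u) A = k * face_sum W A.
Proof. by rewrite /face_sum mulr_sumr; apply: eq_bigr => i _; rewrite mulrCA. Qed.

Lemma lie_diff_scale q r k (W : ('I_r -> ambPG R 4 q) -> R) A :
  lie_diff (fun u => k * W u) A = k * lie_diff W A.
Proof.
rewrite /lie_diff mulr_sumr; apply: eq_bigr => i _.
by rewrite -mulr_sumr mulrCA.
Qed.

Lemma face_sum0 q r A : face_sum (fun _ : 'I_r -> ambPG R 4 q => 0) A = 0.
Proof. by rewrite /face_sum big1 // => i _; rewrite mulr0. Qed.

Lemma lie_diff0 q r A : lie_diff (fun _ : 'I_r -> ambPG R 4 q => 0) A = 0.
Proof. by rewrite /lie_diff big1 // => i _; rewrite big1 ?mulr0. Qed.

Lemma cochain13E (A : 'I_3 -> ambPG R 4 1) : (forall i k, skew (pr i (A k))) ->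
  face_sum cochain03 A + (-1) ^+ 1 * lie_diff cochain12 A = cochain13 A.
Proof.
move=> sA; rewrite /cochain03 face_sum_scale /cochain12 lie_diff_scale /cochain13.
have {sA} := pfaff_component13 sA.
move: (_^-1) (face_sum _ _) (lie_diff _ _) (pfaff3_cochain _ _) => k x y z xyz.
by transitivity (- k * (2 * z)); [rewrite -xyz|]; ring.
Qed.

Lemma cochain22E (A : 'I_2 -> ambPG R 4 2) :
  face_sum cochain12 A = cochain22 A.
Proof. by rewrite /cochain12 face_sum_scale pfaff_component22. Qed.

Lemma lie_diff_cochain03 (A : 'I_4 -> ambPG R 4 0) :
  (forall i k, skew (pr i (A k))) -> lie_diff cochain03 A = 0.
Proof. by move=> sA; rewrite /cochain03 lie_diff_scale lie_diff_pfaff3 ?mulr0. Qed.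

Lemma lie_diff_cochain13 (A : 'I_4 -> ambPG R 4 1) :
  (forall i k, skew (pr i (A k))) -> lie_diff cochain13 A = 0.
Proof. by move=> sA; rewrite /cochain13 lie_diff_scale lie_diff_pfaff3_sub ?mulr0. Qed.

Lemma cochain_cocycle23 (A : 'I_3 -> ambPG R 4 2) :
  (forall i k, skew (pr i (A k))) ->
  face_sum cochain13 A + (-1) ^+ 2 * lie_diff cochain22 A = 0.
Proof.
move=> sA; rewrite /cochain13 face_sum_scale /cochain22 lie_diff_scale.
have {sA} := pfaff_cocycle23 sA.
move: (_^-1) (face_sum _ _) (lie_diff _ _) => k x y xy.
transitivity (- k * (2 * x + y)); first by ring.
by rewrite xy mulr0.
Qed.

Lemma face_sum_cochain22 (A : 'I_2 -> ambPG R 4 3) : face_sum cochain22 A = 0.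
Proof. by rewrite /cochain22 face_sum_scale pfaff_cocycle32 mulr0. Qed.

Lemma lie_total_diff_TE q r (A : 'I_r -> ambPG R 4 q) :
  (forall i k, skew (pr i (A k))) ->
  lie_total_diff TE_lie A = Ebar_lie q r A.
Proof.
case: q r A => [|[|[|q]]] [|[|[|[|[|r]]]]] A sA; rewrite /lie_total_diff /=;
  rewrite ?face_sum0 ?lie_diff0 ?(mulr0, addr0, add0r) //.
- by rewrite lie_diff_cochain03 // mulr0.
- exact: cochain13E.
- exact: cochain22E.
Qed.

Lemma lie_total_diff_Ebar q r (A : 'I_r -> ambPG R 4 q) :
  (forall i k, skew (pr i (A k))) -> lie_total_diff Ebar_lie A = 0.
Proof.
case: q r A => [|[|[|[|q]]]] [|[|[|[|[|r]]]]] A sA; rewrite /lie_total_diff /=;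
  rewrite ?face_sum0 ?lie_diff0 ?(mulr0, addr0, add0r) //.
- by rewrite lie_diff_cochain13 // mulr0.
- exact: cochain_cocycle23.
- exact: face_sum_cochain22.
Qed.

End TotalComplex.

Theorem theorem3p7 (R : realType) :
  let G := @SO R 4 in
  let Ebar : cochain := I_Delta (@PfOmega R) in
  [/\ chern_simons_form G 3 (I_Delta TPf) Ebar,
      cochain_eq G (I_Delta TPf) TE
    & [/\ form_eq (PG G (q := 0)) (d'' G TE03) (zero_form 4),
          form_eq (PG G (q := 1))
            (fun p v => d' TE03 p v + d'' G TE12 p v) (Ebar 1%N 3%N)
        & form_eq (PG G (q := 2)) (d' TE12) (Ebar 2%N 2%N)]].
Proof.
move=> G Ebar; split.
- split.
  + split; first exact: (total_cochain_inv_form Ebar_lie_form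
      I_Delta_PfOmega_inv_form Ebar_lie_off).
    move=> q r.
    apply: (form_eq_trans (total_diff_inv_form Ebar_lie_form
      I_Delta_PfOmega_inv_form (q := q) (r := r))).
    by apply: (inv_form_eq (W' := fun=> 0)) => A; exact: lie_total_diff_Ebar.
  + exact: (total_cochain_inv_form TE_lie_form I_Delta_TPf_inv_form TE_lie_off).
  + move=> q r.
    apply: (form_eq_trans (total_diff_inv_form TE_lie_form
      I_Delta_TPf_inv_form (q := q) (r := r))).
    apply: (form_eq_trans (w2 := inv_form (@Ebar_lie R q r))).
      by apply: inv_form_eq => A; exact: lie_total_diff_TE.
    by apply: form_eq_sym; exact: I_Delta_PfOmega_inv_form.
- move=> q r; apply: (form_eq_trans (I_Delta_TPf_inv_form (q := q) (r := r))).
  by apply: form_eq_sym; exact: TE_inv_form.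
- have [L03 A03] := @TE_lie_form R 0 3; have [L12 A12] := @TE_lie_form R 1 2.
  have D03 := d''_inv_form L03 A03 (@TE03E R).
  have D12 := d''_inv_form L12 A12 (@TE12E R).
  split.
  + apply: (form_eq_trans D03).
    apply: (inv_form_eq (W' := fun=> 0)) => A sA.
    by rewrite lie_diff_cochain03 // mulr0.
  + apply: (form_eq_trans (w2 := inv_form cochain13)); last first.
      by apply: form_eq_sym; exact: (@I_Delta_PfOmega_inv_form R 1 3).
    move=> p v Gp Tv; rewrite (d'_inv_form (@TE03E R)) // D12 //.
    by apply: cochain13E => i k; exact: tangent_PG_skew.
  + apply: (form_eq_trans (d'_inv_form (@TE12E R))).
    apply: (form_eq_trans (w2 := inv_form cochain22)).
      by apply: inv_form_eq => A _; exact: cochain22E.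
    by apply: form_eq_sym; exact: (@I_Delta_PfOmega_inv_form R 2 2).
Qed.
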